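(* Let $R$ be a Gorenstein local ring of prime characteristic $p>0$ such that ${}^{f^n}\! R$ is locally strongly rigid for some $n>0$ (fix such an $n$), and let $M$ be a finitely generated $R$-module. The following are equivalent: (1) $M$ has finite projective dimension; (2) $\operatorname{Ass} F^n(M)\subseteq \operatorname{FPD}(M)$.
   Context: All rings are commutative Noetherian local of prime characteristic $p>0$. The Frobenius endomorphism is $f\colon R\to R$, $f(r)=r^p$, with iterates $f^n(r)=r^{p^n}$. ${}^{f^n}\! R$ denotes $R$ viewed as an $R$-module by restriction of scalars along $f^n$. The Frobenius functor is $F^n(M)=M\otimes_R {}^{f^n}\! R$, i.e. base change along $f^n$; its $R$-module structure is by ordinary multiplication on the right-hand factor. An $R$-module $N$ (not necessarily finitely generated) is strongly rigid if for any integer $i>0$ and any finitely generated $R$-module $M$, $\operatorname{Tor}_i^R(M,N)=0$ implies $\operatorname{pd}_R M<\infty$ (projective dimension). $N$ is locally strongly rigid if $N_{\mathfrak p}$ is strongly rigid over $R_{\mathfrak p}$ for all $\mathfrak p\in\operatorname{Spec} R$. $\operatorname{FPD}(M)=\{\mathfrak p\in\operatorname{Spec} R : \operatorname{pd}_{R_{\mathfrak p}} M_{\mathfrak p}<\infty\}$ is the finite projective dimension locus of $M$ (the zero module is regarded as having finite projective dimension). *)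

(* Defs.v *)
From HB Require Import structures.
From mathcomp Require Import all_boot all_algebra.
From mathcomp Require Import ring.
From mathcomp Require Import boolp.

Set Implicit Arguments.
Unset Strict Implicit.
Unset Printing Implicit Defensive.

Import GRing.Theory.

Local Open Scope ring_scope.
Local Open Scope quotient_scope.

(* Ideals are the library's [idealr] (proper ideals) and [prime_idealr], which
   are boolean predicates; since [boolp.asbool] turns every [Prop]-valued
   predicate into a boolean one, these are all the proper (prime) ideals. *)

Section Rings.
Variable R : comNzRingType.

Definition noetherian : Prop :=
  forall I : {pred R^o}, submod_closed I ->
  exists (k : nat) (g : 'I_k -> R),
    forall x : R, x \in I <-> exists c : 'I_k -> R, x = \sum_i c i * g i.

Definition maximal_ideal (m : idealr R) : Prop :=
  forall J : idealr R, {subset m <= J} -> J =i m.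

Definition local_ring : Prop :=
  exists2 m : idealr R, maximal_ideal m &
    forall m' : idealr R, maximal_ideal m' -> m' =i m.

End Rings.
Arguments noetherian R : clear implicits.
Arguments local_ring R : clear implicits.

Section Modules.
Variable R : comNzRingType.
Implicit Types M N : lmodType R.

Definition fin_gen M : Prop :=
  exists (k : nat) (g : 'I_k -> M),
    forall x : M, exists c : 'I_k -> R, x = \sum_i c i *: g i.

Definition surj (A B : Type) (f : A -> B) : Prop := forall y, exists x, f x = y.

Definition exact_at (A B C : zmodType) (f : A -> B) (g : B -> C) : Prop :=
  forall y : B, g y = 0 <-> exists x, f x = y.

Definition projective (P : lmodType R) : Prop :=
  forall (A B : lmodType R) (g : {linear A -> B}) (h : {linear P -> B}),
    surj g -> exists h' : {linear P -> A}, forall x, g (h' x) = h x.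

Definition injective_module (E : lmodType R) : Prop :=
  forall (A B : lmodType R) (g : {linear A -> B}) (h : {linear A -> E}),
    injective g -> exists h' : {linear B -> E}, forall x, h' (g x) = h x.

(* ... -> P_2 -> P_1 -> P_0 -> M -> 0 *)
Record proj_resolution M := ProjResolution {
  pres_obj :> nat -> lmodType R;
  pres_d : forall i, {linear pres_obj i.+1 -> pres_obj i};
  pres_aug : {linear pres_obj 0 -> M};
  pres_projective : forall i, projective (pres_obj i);
  pres_aug_surj : surj pres_aug;
  pres_exact0 : exact_at (pres_d 0) pres_aug;
  pres_exactS : forall i, exact_at (pres_d i.+1) (pres_d i) }.

(* 0 -> M -> E_0 -> E_1 -> E_2 -> ... *)
Record inj_resolution M := InjResolution {
  ires_obj :> nat -> lmodType R;
  ires_d : forall i, {linear ires_obj i -> ires_obj i.+1};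
  ires_aug : {linear M -> ires_obj 0};
  ires_injective : forall i, injective_module (ires_obj i);
  ires_aug_inj : injective ires_aug;
  ires_exact0 : exact_at ires_aug (ires_d 0);
  ires_exactS : forall i, exact_at (ires_d i) (ires_d i.+1) }.

Definition finite_projdim M : Prop :=
  exists (P : proj_resolution M) (l : nat),
    forall i, (l < i)%N -> forall x : P i, x = 0.

Definition finite_injdim M : Prop :=
  exists (E : inj_resolution M) (l : nat),
    forall i, (l < i)%N -> forall x : E i, x = 0.

Definition Ass M (P : prime_idealr R) : Prop :=
  exists x : M, forall a : R, a \in P <-> a *: x = 0.

End Modules.

Definition gorenstein_local (R : comNzRingType) : Prop :=
  [/\ noetherian R, local_ring R & finite_injdim (R^o : lmodType R)].

(* The tensor product: formal sums of pairs, modulo the congruence generated by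
   commutativity and bilinearity. *)

Section Tensor.
Variable R : comNzRingType.

Section Construction.
Variables M N : lmodType R.

Inductive tensor_rel : seq (M * N) -> seq (M * N) -> Prop :=
| TRrefl s : tensor_rel s s
| TRsym s t : tensor_rel s t -> tensor_rel t s
| TRtrans s t u : tensor_rel s t -> tensor_rel t u -> tensor_rel s u
| TRcat s s' t t' :
    tensor_rel s s' -> tensor_rel t t' -> tensor_rel (s ++ t) (s' ++ t')
| TRcomm s t : tensor_rel (s ++ t) (t ++ s)
| TR0l y : tensor_rel [:: (0, y)] [::]
| TRDl x x' y : tensor_rel [:: (x + x', y)] [:: (x, y); (x', y)]
| TRDr x y y' : tensor_rel [:: (x, y + y')] [:: (x, y); (x, y')]
| TRZ a x y : tensor_rel [:: (a *: x, y)] [:: (x, a *: y)].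

Definition tensor_eqv s t := `[< tensor_rel s t >].

Lemma tensor_eqv_equiv : equiv_class_of tensor_eqv.
Proof.
split=> [s|s t|t s u].
- by apply/asboolP; apply: TRrefl.
- by apply/asboolP/asboolP; apply: TRsym.
- by move=> /asboolP st /asboolP tu; apply/asboolP; apply: TRtrans st tu.
Qed.
Canonical tensor_eqv_equivRel := EquivRelPack tensor_eqv_equiv.
Canonical tensor_eqv_encModRel := defaultEncModRel tensor_eqv.

Definition tensor : Type := {eq_quot tensor_eqv}.
HB.instance Definition _ : EqQuotient _ tensor_eqv tensor :=
  EqQuotient.on tensor.
HB.instance Definition _ := Choice.on tensor.

Definition tpi (s : seq (M * N)) : tensor := \pi_tensor s.

Lemma tpiP s t : tpi s = tpi t <-> tensor_rel s t.
Proof.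
by split=> [/eqmodP/asboolP//|st]; apply/eqmodP/asboolP.
Qed.

Lemma tpi_repr s : tensor_rel (repr (tpi s)) s.
Proof. by apply/tpiP; rewrite /tpi reprK. Qed.

Lemma tensorW (P : tensor -> Prop) : (forall s, P (tpi s)) -> forall t, P t.
Proof. by move=> Ps t; rewrite -[t]reprK; apply: Ps. Qed.

Definition pure_tensor (x : M) (y : N) : tensor := tpi [:: (x, y)].

Definition tadd (t u : tensor) : tensor := tpi (repr t ++ repr u).

Lemma tadd_tpi s t : tadd (tpi s) (tpi t) = tpi (s ++ t).
Proof. by apply/tpiP; apply: TRcat; apply: tpi_repr. Qed.

Fact taddA : associative tadd.
Proof.
elim/tensorW=> s t u; elim/tensorW: t => t; elim/tensorW: u => u.
by rewrite !tadd_tpi catA.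
Qed.

Fact taddC : commutative tadd.
Proof.
elim/tensorW=> s t; elim/tensorW: t => t; rewrite !tadd_tpi.
by apply/tpiP; apply: TRcomm.
Qed.

Fact tadd0 : left_id (tpi [::]) tadd.
Proof. by elim/tensorW=> s; rewrite tadd_tpi. Qed.

HB.instance Definition _ := GRing.isNmodule.Build tensor taddA taddC tadd0.

Lemma tpi_cat s t : tpi (s ++ t) = tpi s + tpi t.
Proof. by rewrite -tadd_tpi. Qed.

Lemma tpi_nil : tpi [::] = 0. Proof. by []. Qed.

Lemma tpi_cons x y s : tpi ((x, y) :: s) = pure_tensor x y + tpi s.
Proof. exact: (tpi_cat [:: (x, y)]). Qed.

Lemma pure0l y : pure_tensor 0 y = 0.
Proof. by apply/tpiP; apply: TR0l. Qed.

Lemma pureDl x x' y :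
  pure_tensor (x + x') y = pure_tensor x y + pure_tensor x' y.
Proof. by rewrite -tpi_cat; apply/tpiP; apply: TRDl. Qed.

Lemma pureDr x y y' :
  pure_tensor x (y + y') = pure_tensor x y + pure_tensor x y'.
Proof. by rewrite -tpi_cat; apply/tpiP; apply: TRDr. Qed.

Lemma pureZ a x y : pure_tensor (a *: x) y = pure_tensor x (a *: y).
Proof. by apply/tpiP; apply: TRZ. Qed.

(* Balanced biadditive maps factor through the tensor product. *)
Section Lift.
Variables (Q : nmodType) (h : M -> N -> Q).
Hypotheses (h0l : forall y, h 0 y = 0)
  (hDl : forall x x' y, h (x + x') y = h x y + h x' y)
  (hDr : forall x y y', h x (y + y') = h x y + h x y')
  (hZ : forall a x y, h (a *: x) y = h x (a *: y)).

Definition tlift (t : tensor) : Q := \sum_(z <- repr t) h z.1 z.2.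

Lemma tlift_rel s t : tensor_rel s t ->
  \sum_(z <- s) h z.1 z.2 = \sum_(z <- t) h z.1 z.2.
Proof.
elim=> {s t} [//|s t _ ->//|s t u _ -> _ ->//|s s' t t' _ es _ et|s t|y|x x' y
             |x y y'|a x y].
- by rewrite !big_cat /= es et.
- by rewrite !big_cat /= addrC.
- by rewrite !(big_cons, big_nil) /= addr0 h0l.
- by rewrite !(big_cons, big_nil) /= !addr0 hDl.
- by rewrite !(big_cons, big_nil) /= !addr0 hDr.
- by rewrite !(big_cons, big_nil) /= !addr0 hZ.
Qed.

Lemma tlift_tpi s : tlift (tpi s) = \sum_(z <- s) h z.1 z.2.
Proof. by apply: tlift_rel; apply: tpi_repr. Qed.

Lemma tlift_pure x y : tlift (pure_tensor x y) = h x y.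
Proof. by rewrite tlift_tpi big_seq1. Qed.

Lemma tlift0 : tlift 0 = 0.
Proof. by rewrite -tpi_nil tlift_tpi big_nil. Qed.

Lemma tliftD : {morph tlift : t u / t + u}.
Proof.
elim/tensorW=> s t; elim/tensorW: t => t.
by rewrite -tpi_cat !tlift_tpi big_cat.
Qed.

End Lift.

Lemma tensor_ind (P : tensor -> Prop) : P 0 ->
  (forall x y t, P t -> P (pure_tensor x y + t)) -> forall t, P t.
Proof.
move=> P0 PD; elim/tensorW; elim=> [//|[x y] s IHs].
by rewrite tpi_cons; apply: PD.
Qed.

Definition topp : tensor -> tensor := tlift (fun x y => pure_tensor (- x) y).

Fact toppP :
  [/\ forall y, pure_tensor (- 0) y = 0,
      forall x x' y, pure_tensor (- (x + x')) y =
                     pure_tensor (- x) y + pure_tensor (- x') y,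
      forall x y y', pure_tensor (- x) (y + y') =
                     pure_tensor (- x) y + pure_tensor (- x) y' &
      forall a x y, pure_tensor (- (a *: x)) y = pure_tensor (- x) (a *: y)].
Proof.
split=> [y|x x' y|x y y'|a x y].
- by rewrite oppr0 pure0l.
- by rewrite opprD pureDl.
- by rewrite pureDr.
- by rewrite -scalerN pureZ.
Qed.

Fact taddN : left_inverse 0 topp +%R.
Proof.
have [o0 oDl oDr oZ] := toppP.
elim/tensor_ind=> [|x y t IHt]; first by rewrite /topp tlift0 ?addr0.
by rewrite /topp tliftD // tlift_pure // addrACA -pureDl addNr pure0l add0r IHt.
Qed.

HB.instance Definition _ := GRing.Nmodule_isZmodule.Build tensor taddN.

Definition tscale (a : R) : tensor -> tensor :=
  tlift (fun x y => pure_tensor (a *: x) y).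

Fact tscaleP a :
  [/\ forall y, pure_tensor (a *: 0) y = 0,
      forall x x' y, pure_tensor (a *: (x + x')) y =
                     pure_tensor (a *: x) y + pure_tensor (a *: x') y,
      forall x y y', pure_tensor (a *: x) (y + y') =
                     pure_tensor (a *: x) y + pure_tensor (a *: x) y' &
      forall b x y, pure_tensor (a *: (b *: x)) y =
                    pure_tensor (a *: x) (b *: y)].
Proof.
split=> [y|x x' y|x y y'|b x y].
- by rewrite scaler0 pure0l.
- by rewrite scalerDr pureDl.
- by rewrite pureDr.
- by rewrite scalerA mulrC -scalerA pureZ.
Qed.

Lemma tscale_pure a x y : tscale a (pure_tensor x y) = pure_tensor (a *: x) y.
Proof. by have [? ? ? ?] := tscaleP a; rewrite /tscale tlift_pure. Qed.

Fact tscale0 a : tscale a 0 = 0.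
Proof. by have [? ? ? ?] := tscaleP a; rewrite /tscale tlift0. Qed.

Fact tscaleDr : right_distributive tscale +%R.
Proof. by move=> a; have [? ? ? ?] := tscaleP a; apply: tliftD. Qed.

Fact tscaleA a b t : tscale a (tscale b t) = tscale (a * b) t.
Proof.
elim/tensor_ind: t => [|x y t IHt]; first by rewrite !tscale0.
by rewrite !tscaleDr !tscale_pure IHt scalerA.
Qed.

Fact tscale1 : left_id 1 tscale.
Proof.
elim/tensor_ind=> [|x y t IHt]; first exact: tscale0.
by rewrite tscaleDr tscale_pure IHt scale1r.
Qed.

Fact tscaleDl t : {morph tscale^~ t : a b / a + b}.
Proof.
move=> a b; elim/tensor_ind: t => [|x y t IHt]; first by rewrite !tscale0 addr0.
by rewrite !tscaleDr !tscale_pure IHt scalerDl pureDl addrACA.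
Qed.

HB.instance Definition _ :=
  GRing.Zmodule_isLmodule.Build R tensor tscaleA tscale1 tscaleDr tscaleDl.

Lemma scale_pure (a : R) x y :
  a *: pure_tensor x y = pure_tensor (a *: x) y.
Proof. exact: tscale_pure. Qed.

End Construction.

Section Map.
Variables (M M' N N' : lmodType R).
Variables (f : {linear M -> M'}) (g : {linear N -> N'}).

Definition tensor_map : tensor M N -> tensor M' N' :=
  tlift (fun x y => pure_tensor (f x) (g y)).

Fact tensor_mapP :
  [/\ forall y, pure_tensor (f 0) (g y) = 0,
      forall x x' y, pure_tensor (f (x + x')) (g y) =
                     pure_tensor (f x) (g y) + pure_tensor (f x') (g y),
      forall x y y', pure_tensor (f x) (g (y + y')) =
                     pure_tensor (f x) (g y) + pure_tensor (f x) (g y') &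
      forall a x y, pure_tensor (f (a *: x)) (g y) =
                    pure_tensor (f x) (g (a *: y))].
Proof.
split=> [y|x x' y|x y y'|a x y].
- by rewrite linear0 pure0l.
- by rewrite linearD pureDl.
- by rewrite linearD pureDr.
- by rewrite !linearZ pureZ.
Qed.

Lemma tensor_map_pure x y :
  tensor_map (pure_tensor x y) = pure_tensor (f x) (g y).
Proof. by have [? ? ? ?] := tensor_mapP; rewrite /tensor_map tlift_pure. Qed.

Fact tensor_map_is_linear : linear tensor_map.
Proof.
have [? ? ? ?] := tensor_mapP.
have mD : {morph tensor_map : t u / t + u} by apply: tliftD.
have m0 : tensor_map 0 = 0 by apply: tlift0.
move=> a t u; rewrite mD; congr (_ + _).
elim/tensor_ind: t => [|x y t IHt]; first by rewrite !(scaler0, m0).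
by rewrite scalerDr !mD IHt scale_pure !tensor_map_pure linearZ scalerDr
           scale_pure.
Qed.

HB.instance Definition _ :=
  GRing.isLinear.Build R (tensor M N) (tensor M' N') *:%R tensor_map
    tensor_map_is_linear.

End Map.
End Tensor.

(* Vanishing of Tor_i(M, N) = H_i(P (x) N) for a projective resolution P of M
   (the homology does not depend on the choice of P). *)
Section Tor.
Variable R : comNzRingType.

Definition tor_d (M N : lmodType R) (P : proj_resolution M) (i : nat) :
    {linear tensor (P i.+1) N -> tensor (P i) N} :=
  tensor_map (pres_d P i) (idfun : {linear N -> N}).

Definition Tor_zero (i : nat) (M N : lmodType R) : Prop :=
  exists P : proj_resolution M,
    match i with
    | 0 => surj (tor_d N P 0)
    | j.+1 => exact_at (tor_d N P j.+1) (tor_d N P j)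
    end.

Definition strongly_rigid (N : lmodType R) : Prop :=
  forall (i : nat) (M : lmodType R), (0 < i)%N -> fin_gen M ->
    Tor_zero i M N -> finite_projdim M.

End Tor.

(* Fractions x / s with x in M and s outside the prime P. *)
Section Localization.
Variables (R : comNzRingType) (P : prime_idealr R).

Definition denom : Type := {s : R | s \notin P}.
HB.instance Definition _ := Choice.on denom.
HB.instance Definition _ := SubType.on denom.

Fact denom1P : 1 \notin P. Proof. by rewrite idealr1. Qed.
Definition denom1 : denom := exist (fun s => is_true (s \notin P)) 1 denom1P.

Fact denomMP (s t : denom) : val s * val t \notin P.
Proof. by rewrite prime_idealrM negb_or (valP s) (valP t). Qed.
Definition denomM (s t : denom) : denom :=
  exist (fun s => is_true (s \notin P)) _ (denomMP s t).

Lemma val_denomM s t : val (denomM s t) = val s * val t. Proof. by []. Qed.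
Lemma val_denom1 : val denom1 = 1. Proof. by []. Qed.

Section Module.
Variable M : lmodType R.

Definition loc_eqv (u v : M * denom) : bool :=
  `[< exists w : denom,
        (val w * val v.2) *: u.1 = (val w * val u.2) *: v.1 >].

Lemma loc_eqv_equiv : equiv_class_of loc_eqv.
Proof.
split=> [[x s]|[x s] [y t]|[y t] [x s] [z r]].
- by apply/asboolP; exists denom1.
- by apply/asboolP/asboolP=> -[w e]; exists w.
- move=> /asboolP[w e] /asboolP[w' e']; apply/asboolP.
  have {}e : (val w * val t) *: x = (val w * val s) *: y := e.
  have {}e' : (val w' * val r) *: y = (val w' * val t) *: z := e'.
  exists (denomM (denomM w w') t); rewrite !val_denomM /fst /snd.
  have -> : val w * val w' * val t * val r
          = (val w' * val r) * (val w * val t) by ring.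
  have -> : val w * val w' * val t * val s
          = (val w * val s) * (val w' * val t) by ring.
  by rewrite -[LHS]scalerA e -[RHS]scalerA -e' !scalerA; congr (_ *: _); ring.
Qed.
Canonical loc_eqv_equivRel := EquivRelPack loc_eqv_equiv.
Canonical loc_eqv_encModRel := defaultEncModRel loc_eqv.

Definition loc_mod : Type := {eq_quot loc_eqv}.
HB.instance Definition _ : EqQuotient _ loc_eqv loc_mod :=
  EqQuotient.on loc_mod.
HB.instance Definition _ := Choice.on loc_mod.

Definition frac (x : M) (s : denom) : loc_mod := \pi_loc_mod (x, s).

Lemma fracP x s y t : frac x s = frac y t <->
  exists w : denom, (val w * val t) *: x = (val w * val s) *: y.
Proof. by split=> [/eqmodP/asboolP//|e]; apply/eqmodP/asboolP. Qed.

Lemma frac_repr (u : loc_mod) : frac (repr u).1 (repr u).2 = u.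
Proof. by rewrite /frac -surjective_pairing reprK. Qed.

Lemma fracW (Q : loc_mod -> Prop) : (forall x s, Q (frac x s)) -> forall u, Q u.
Proof. by move=> Qf u; rewrite -(frac_repr u). Qed.

Definition loc_add (u v : loc_mod) : loc_mod :=
  frac (val (repr v).2 *: (repr u).1 + val (repr u).2 *: (repr v).1)
       (denomM (repr u).2 (repr v).2).

Lemma loc_add_frac x s y t : loc_add (frac x s) (frac y t) =
  frac (val t *: x + val s *: y) (denomM s t).
Proof.
rewrite /loc_add; have := frac_repr (frac y t); have := frac_repr (frac x s).
move: (repr (frac x s)) (repr (frac y t)) => -[x0 s0] [y0 t0].
rewrite /fst /snd => /fracP[w e] /fracP[w' e'].
apply/fracP; exists (denomM w w'); rewrite !val_denomM !scalerDr !scalerA.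
congr (_ + _).
- have -> : val w * val w' * (val s * val t) * val t0
          = (val w' * val t * val t0) * (val w * val s) by ring.
  by rewrite -scalerA e scalerA; congr (_ *: _); ring.
- have -> : val w * val w' * (val s * val t) * val s0
          = (val w * val s * val s0) * (val w' * val t) by ring.
  by rewrite -scalerA e' scalerA; congr (_ *: _); ring.
Qed.

Lemma frac_eq x s y t : val t *: x = val s *: y -> frac x s = frac y t.
Proof. by move=> e; apply/fracP; exists denom1; rewrite !mul1r. Qed.

Fact loc_addA : associative loc_add.
Proof.
elim/fracW=> x s v w; elim/fracW: v => y t; elim/fracW: w => z r.
rewrite !loc_add_frac; apply: frac_eq; rewrite !val_denomM.
rewrite !scalerDr !scalerA !addrA.
by congr (_ *: _ + _ *: _ + _ *: _); ring.
Qed.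

Fact loc_addC : commutative loc_add.
Proof.
elim/fracW=> x s v; elim/fracW: v => y t.
rewrite !loc_add_frac addrC; apply: frac_eq.
by rewrite !val_denomM mulrC.
Qed.

Fact loc_add0 : left_id (frac 0 denom1) loc_add.
Proof.
elim/fracW=> x s; rewrite loc_add_frac scaler0 add0r; apply: frac_eq.
by rewrite val_denomM mul1r scale1r.
Qed.

Definition loc_opp (u : loc_mod) : loc_mod := frac (- (repr u).1) (repr u).2.

Fact loc_addN : left_inverse (frac 0 denom1) loc_opp loc_add.
Proof.
move=> u; rewrite -{2}(frac_repr u) loc_add_frac; apply: frac_eq.
by rewrite scalerN addNr !scaler0.
Qed.

HB.instance Definition _ :=
  GRing.isZmodule.Build loc_mod loc_addA loc_addC loc_add0 loc_addN.

Lemma add_frac x s y t :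
  frac x s + frac y t = frac (val t *: x + val s *: y) (denomM s t).
Proof. exact: loc_add_frac. Qed.

Lemma frac0 s : frac 0 s = 0.
Proof. by apply: frac_eq; rewrite !scaler0. Qed.

Lemma add_frac_same x y s : frac x s + frac y s = frac (x + y) s.
Proof.
by rewrite add_frac -scalerDr; apply: frac_eq; rewrite scalerA val_denomM.
Qed.

End Module.

Section Scale.
Variable M : lmodType R.

Definition loc_scale (a : loc_mod R^o) (u : loc_mod M) : loc_mod M :=
  frac (((repr a).1 : R) *: (repr u).1) (denomM (repr a).2 (repr u).2).

Lemma loc_scale_frac (a : R) s (x : M) t :
  loc_scale (frac (a : R^o) s) (frac x t) = frac (a *: x) (denomM s t).
Proof.
rewrite /loc_scale.
have := frac_repr (frac x t); have := frac_repr (frac (a : R^o) s).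
move: (repr (frac _ s)) (repr (frac _ t)) => -[a0 s0] [x0 t0].
rewrite /fst /snd => /fracP[w e] /fracP[w' e'].
have {}e : val w * val s * a0 = val w * val s0 * a by [].
apply/fracP; exists (denomM w w'); rewrite !val_denomM !scalerA.
have -> : val w * val w' * (val s * val t) * a0
        = (val w * val s * a0) * (val w' * val t) by ring.
by rewrite e -scalerA e' scalerA; congr (_ *: _); ring.
Qed.

Fact loc_scale1 u : loc_scale (frac (1 : R^o) denom1) u = u.
Proof.
elim/fracW: u => x s; rewrite loc_scale_frac; apply: frac_eq.
by rewrite val_denomM scale1r mul1r.
Qed.

Fact loc_scaleDr : right_distributive loc_scale +%R.
Proof.
elim/fracW=> a r u v; elim/fracW: u => x s; elim/fracW: v => y t.
rewrite (add_frac x s y t) !loc_scale_frac add_frac; apply: frac_eq.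
rewrite !val_denomM !scalerDr !scalerA.
by congr (_ *: _ + _ *: _); ring.
Qed.

Fact loc_scaleDl_frac (a b : R) s t (x : M) r :
  loc_scale (frac (a : R^o) s + frac (b : R^o) t) (frac x r) =
  loc_scale (frac (a : R^o) s) (frac x r) +
  loc_scale (frac (b : R^o) t) (frac x r).
Proof.
rewrite (add_frac (a : R^o) s (b : R^o) t).
rewrite (loc_scale_frac (val t * a + val s * b)) !loc_scale_frac add_frac.
apply: frac_eq; rewrite !val_denomM !scalerA -scalerDl !scalerA.
by congr (_ *: _); ring.
Qed.

Fact loc_scaleDl u : {morph loc_scale^~ u : a b / a + b}.
Proof.
elim/fracW: u => x r a b; elim/fracW: a => a s; elim/fracW: b => b t.
exact: loc_scaleDl_frac.
Qed.

End Scale.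

Fact loc_scaleA_frac (M : lmodType R) (a b : R) s t (x : M) r :
  loc_scale (frac (a : R^o) s) (loc_scale (frac (b : R^o) t) (frac x r)) =
  loc_scale (loc_scale (frac (a : R^o) s) (frac (b : R^o) t)) (frac x r).
Proof.
rewrite (loc_scale_frac b t x r) (loc_scale_frac a s (b : R^o) t).
rewrite (loc_scale_frac (a * b)) loc_scale_frac.
apply: frac_eq; rewrite !val_denomM !scalerA.
by congr (_ *: _); ring.
Qed.

Fact loc_scaleA (M : lmodType R) a b (u : loc_mod M) :
  loc_scale a (loc_scale b u) = loc_scale (loc_scale a b) u.
Proof.
elim/fracW: a => a s; elim/fracW: b => b t; elim/fracW: u => x r.
exact: loc_scaleA_frac.
Qed.

Definition loc_ring : Type := loc_mod R^o.
HB.instance Definition _ := GRing.Zmodule.on loc_ring.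

Definition loc_mul (a b : loc_ring) : loc_ring := loc_scale a b.

Fact loc_mulA : associative loc_mul.
Proof. exact: loc_scaleA. Qed.

Fact loc_mulC_frac (a b : R) s t :
  loc_scale (frac (a : R^o) s) (frac (b : R^o) t) =
  loc_scale (frac (b : R^o) t) (frac (a : R^o) s).
Proof.
rewrite (loc_scale_frac a s (b : R^o)) (loc_scale_frac b t (a : R^o)).
apply: frac_eq; rewrite !val_denomM [val t * _]mulrC.
by congr (_ *: _); apply: mulrC.
Qed.

Fact loc_mulC : commutative loc_mul.
Proof.
elim/fracW=> a s v; elim/fracW: v => b t; exact: loc_mulC_frac.
Qed.

Fact loc_mul1 : left_id (frac (1 : R^o) denom1) loc_mul.
Proof. exact: loc_scale1. Qed.

Fact loc_mulDl : left_distributive loc_mul +%R.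
Proof. by move=> a b c; apply: loc_scaleDl. Qed.

Fact loc_1neq0 : frac (1 : R^o) denom1 != 0 :> loc_ring.
Proof.
apply/eqP=> /fracP[w]; rewrite scaler0 mulr1 => /(congr1 (fun x : R => x \in P)).
by rewrite -[_ *: _]/(_ * _) mulr1 rpred0 (negPf (valP w)).
Qed.

HB.instance Definition _ := GRing.Zmodule_isComNzRing.Build loc_ring
  loc_mulA loc_mulC loc_mul1 loc_mulDl loc_1neq0.

HB.instance Definition _ (M : lmodType R) :=
  GRing.Zmodule_isLmodule.Build loc_ring (loc_mod M)
    (@loc_scaleA M) (@loc_scale1 M) (@loc_scaleDr M) (@loc_scaleDl M).

End Localization.

Section Local.
Variable R : comNzRingType.

Definition locally_strongly_rigid (N : lmodType R) : Prop :=
  forall P : prime_idealr R, strongly_rigid (loc_mod P N : lmodType (loc_ring P)).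

Definition FPD (M : lmodType R) (P : prime_idealr R) : Prop :=
  finite_projdim (loc_mod P M : lmodType (loc_ring P)).

End Local.

Definition restrict_scalars (R S : comNzRingType) (phi : {rmorphism R -> S})
  (N : lmodType S) : Type := N.
Arguments restrict_scalars {R S} phi N.

Section RestrictScalars.
Variables (R S : comNzRingType) (phi : {rmorphism R -> S}).

Section Restrict.
Variable N : lmodType S.

Local Notation rN := (restrict_scalars phi N).
HB.instance Definition _ := GRing.Zmodule.on rN.

Definition rscale (a : R) (x : rN) : rN :=
  phi a *: (x : N).

Fact rscaleA a b x : rscale a (rscale b x) = rscale (a * b) x.
Proof. by rewrite /rscale scalerA rmorphM. Qed.
Fact rscale1 : left_id 1 rscale.
Proof. by move=> x; rewrite /rscale rmorph1 scale1r. Qed.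
Fact rscaleDr : right_distributive rscale +%R.
Proof. by move=> a x y; rewrite /rscale scalerDr. Qed.
Fact rscaleDl x : {morph rscale^~ x : a b / a + b}.
Proof. by move=> a b; rewrite /rscale rmorphD scalerDl. Qed.

HB.instance Definition _ := GRing.Zmodule_isLmodule.Build R rN
  rscaleA rscale1 rscaleDr rscaleDl.

End Restrict.

(* [S] acts on the right-hand factor of [M (x)_R S]. *)

Definition rmul (b : S) (x : restrict_scalars phi S^o) : restrict_scalars phi S^o :=
  b * (x : S).

Fact rmul_is_linear b : linear (rmul b).
Proof. by move=> a x y; rewrite /rmul mulrDr; congr (_ + _); apply: mulrCA. Qed.

HB.instance Definition _ b :=
  GRing.isLinear.Build R (restrict_scalars phi S^o) (restrict_scalars phi S^o) *:%R
    (rmul b) (rmul_is_linear b).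

Section BaseChange.
Variable M : lmodType R.

Definition base_change : Type := tensor M (restrict_scalars phi S^o).
HB.instance Definition _ := GRing.Zmodule.on base_change.

Definition bscale (b : S) : base_change -> base_change :=
  tensor_map (idfun : {linear M -> M}) (rmul b).

Lemma bscale_pure b x c :
  bscale b (pure_tensor x c) =
  pure_tensor x ((b * c : S) : restrict_scalars phi S^o).
Proof. exact: tensor_map_pure. Qed.

Fact bscaleDr : right_distributive bscale +%R.
Proof. by move=> b t u; rewrite /bscale linearD. Qed.

Fact bscale0 b : bscale b 0 = 0.
Proof. exact: linear0. Qed.

Fact bscaleA b c t : bscale b (bscale c t) = bscale (b * c) t.
Proof.
elim/tensor_ind: t => [|x y t IHt]; first by rewrite !bscale0.
by rewrite !bscaleDr IHt !bscale_pure mulrA.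
Qed.

Fact bscale1 : left_id 1 bscale.
Proof.
elim/tensor_ind=> [|x y t IHt]; first exact: bscale0.
by rewrite bscaleDr IHt bscale_pure mul1r.
Qed.

Fact bscaleDl t : {morph bscale^~ t : b c / b + c}.
Proof.
move=> b c; elim/tensor_ind: t => [|x y t IHt].
  by rewrite !bscale0 addr0.
by rewrite !bscaleDr IHt !bscale_pure mulrDl pureDr addrACA.
Qed.

HB.instance Definition _ := GRing.Zmodule_isLmodule.Build S base_change
  bscaleA bscale1 bscaleDr bscaleDl.

End BaseChange.
End RestrictScalars.

Section Frobenius.
Variables (R : comNzRingType) (p : nat) (pcharR : p \in [pchar R]) (n : nat).

Definition frob_iter of p \in [pchar R] := fun r : R => r ^+ (p ^ n).
Local Notation f := (frob_iter pcharR).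

Fact frob_iter_is_zmod_morphism : zmod_morphism f.
Proof.
have pn : [pchar R].-nat (p ^ n)%N.
  by rewrite pnatX; apply/orP; left; rewrite pnatE ?(pcharf_prime pcharR).
by move=> x y; rewrite /frob_iter exprDn_pchar // exprNn_pchar.
Qed.

Fact frob_iter_is_monoid_morphism : monoid_morphism f.
Proof. by split=> [|x y]; rewrite /frob_iter ?expr1n ?exprMn. Qed.

HB.instance Definition _ :=
  GRing.isZmodMorphism.Build R R f frob_iter_is_zmod_morphism.
HB.instance Definition _ :=
  GRing.isMonoidMorphism.Build R R f frob_iter_is_monoid_morphism.

Definition frob_module : lmodType R := restrict_scalars f (R^o : lmodType R).

Definition frob_functor (M : lmodType R) : lmodType R := base_change f M.

End Frobenius.
Arguments frob_module {R p} pcharR n.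
Arguments frob_functor {R p} pcharR n M.

Lemma frob_module_scale (R : comNzRingType) (p : nat)
    (pcharR : p \in [pchar R]) (n : nat) (a x : R) :
  a *: (x : frob_module pcharR n) = (a ^+ (p ^ n) * x : R).
Proof. by []. Qed.

Lemma frob_functor_scale (R : comNzRingType) (p : nat)
    (pcharR : p \in [pchar R]) (n : nat) (M : lmodType R) (a : R) (x : M)
    (c : frob_module pcharR n) :
  a *: (pure_tensor x c : frob_functor pcharR n M) =
  pure_tensor x ((a * c : R) : frob_module pcharR n).
Proof. exact: bscale_pure. Qed.

Lemma loc_mod_scale (R : comNzRingType) (P : prime_idealr R) (M : lmodType R)
    (a : R) (s : denom P) (x : M) (t : denom P) :
  (frac (a : R^o) s : loc_ring P) *: frac x t = frac (a *: x) (denomM s t).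
Proof. exact: loc_scale_frac. Qed.

(* Main.v *)
From HB Require Import structures.
From mathcomp Require Import all_boot all_algebra.
From mathcomp Require Import ring.
From mathcomp Require Import boolp.
Require Import Defs.

Set Implicit Arguments.
Unset Strict Implicit.
Unset Printing Implicit Defensive.

Import GRing.Theory.
Local Open Scope ring_scope.

(** Let L be a resolution of M by finitely generated free modules.  A complex is
written as a sequence of matrices acting on row vectors, so F^n of it is obtained
by raising all entries to the power p^n.  Everything about projective dimension
is expressed by one matrix identity, [contracts 1 d j]: the complex splits at
position j+1.  A resolution of M splits at all large positions exactly when M has
finite projective dimension ([presentation_projdim], [contracts_projdim]).  As
splitting survives localization, (1) implies (2): indeed FPD(M) is then the
whole spectrum.

For the converse, three facts are combined.

First, over a Gorenstein ring M embeds in a module Q of finite projective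
dimension.  The dual of L is exact in high degrees, since Ext^j(-, R) vanishes
for large j; so a high syzygy of M can be continued indefinitely to the right by
cosyzygies ([cosyzygy_step]).  Doing this a finite number of times produces a
resolution D of some finitely generated module X together with a chain map h of
degree -1 from D to L which is invertible in high degrees ([gorenstein_hull]).
The cone of h resolves a module Q with 0 -> M -> Q -> X -> 0, and it splits in
high degrees because h is invertible there, so Q has finite projective dimension.
Since D and L agree in high degrees, M and X have the same finite projective
dimension locus ([hull_contracts]).

Secondly, the theorem of Peskine and Szpiro: if a resolution splits at all large
positions then its Frobenius twist is still acyclic ([frob_acyclic_loc]).  Hence
Tor_1(Q, f^n R) = 0, and Tor_1(X, f^n R), which is H_1 of the twist of D, is
embedded in F^n(M) ([frob_hull_injective]).

Thirdly, a nonzero Tor_1(X, f^n R) would have an associated prime q.  It would be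
associated to F^n(M), so by (2) the localizations M_q and X_q would have finite
projective dimension, and Peskine and Szpiro's theorem at q would make
Tor_1(X, f^n R) vanish at q, which is absurd.  So Tor_1(X, f^n R) = 0, and strong
rigidity at the maximal ideal gives that X, hence M, has finite projective
dimension.

Peskine and Szpiro's theorem is reduced, through an associated prime of the last
nonvanishing homology module, to a local statement ([no_socle_class]) about a
homology class killed by the maximal ideal.  The usual proof cuts down by a
maximal regular sequence.  Here a module V without socle is replaced instead by
the cokernel V' of the map V -> V^g given by generators a_1, ..., a_g of the
maximal ideal, whose depth is one less.  Each such step moves the class one
position to the left ([koszul_class]), and costs one position of exactness.
Either the class eventually lies where the complex splits, or a socle appears,
in which case the argument of Auslander and Buchsbaum shows that the complex
already splits where the class lies ([socle_contracts]). *)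

(** * Complexes of matrices, and linear algebra over a local ring *)

Section Complexes.
Variable R : comNzRingType.
Implicit Types (n : nat -> nat).

Definition is_complex n (d : forall j, 'M[R]_(n j.+1, n j)) :=
  forall j, d j.+1 *m d j = 0.

Definition acyclic n (d : forall j, 'M[R]_(n j.+1, n j)) :=
  forall j (v : 'rV_(n j.+1)), v *m d j = 0 -> exists w, v = w *m d j.+1.

(** A homotopy from multiplication by h to zero at position j+1.  Being an
equation between matrices it is preserved by every ring morphism; the factor h
is there to clear denominators, the complex splitting at the primes that do not
contain h. *)
Definition contracts (h : R) n (d : forall j, 'M[R]_(n j.+1, n j)) j :=
  exists C D, h%:M = C *m d j.+1 + d j *m D.

End Complexes.

Section Local.
Variables (R : comNzRingType) (g : nat) (a : 'I_g -> R).

Definition in_span (x : R) := exists c : 'I_g -> R, x = \sum_k c k * a k.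

Lemma in_span0 : in_span 0.
Proof. by exists (fun=> 0); rewrite big1 // => k _; rewrite mul0r. Qed.

Lemma in_spanD x y : in_span x -> in_span y -> in_span (x + y).
Proof.
move=> [c ->] [c' ->]; exists (fun k => c k + c' k).
by rewrite -big_split; apply: eq_bigr => k _; rewrite mulrDl.
Qed.

Lemma in_spanM x y : in_span y -> in_span (x * y).
Proof.
move=> [c ->]; exists (fun k => x * c k).
by rewrite mulr_sumr; apply: eq_bigr => k _; rewrite mulrA.
Qed.

Lemma in_spanN x : in_span x -> in_span (- x).
Proof. by rewrite -mulN1r; apply: in_spanM. Qed.

Lemma in_span_gen k : in_span (a k).
Proof.
exists (fun i => (i == k)%:R); rewrite (bigD1 k) //= eqxx mul1r big1 ?addr0 //.
by move=> i /negPf->; rewrite mul0r.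
Qed.

Lemma in_span_sum (I : finType) (P : pred I) (F : I -> R) :
  (forall i, in_span (F i)) -> in_span (\sum_(i | P i) F i).
Proof.
move=> FP; apply: big_ind => //; [exact: in_span0 | exact: in_spanD].
Qed.

Lemma in_span_mulmx m n p (A : 'M[R]_(m, n)) (B : 'M_(n, p)) :
  (forall i j, in_span (B i j)) -> forall i j, in_span ((A *m B) i j).
Proof.
by move=> BP i j; rewrite mxE; apply: in_span_sum => k; apply: in_spanM.
Qed.

Lemma in_span_mulmxr m n p (A : 'M[R]_(m, n)) (B : 'M_(n, p)) :
  (forall i j, in_span (A i j)) -> forall i j, in_span ((A *m B) i j).
Proof.
move=> AP i j; rewrite mxE; apply: in_span_sum => k.
by rewrite mulrC; apply: in_spanM.
Qed.

Lemma in_span_det n (A B : 'M[R]_n) :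
  (forall i j, in_span (A i j - B i j)) -> in_span (\det A - \det B).
Proof.
move=> AB; rewrite /determinant -sumrB; apply: in_span_sum => s.
rewrite -mulrBr; apply: in_spanM.
pose K (x y : R) := in_span (x - y).
apply: (@big_ind2 _ _ K); rewrite /K.
- by rewrite subrr; apply: in_span0.
- move=> x1 x2 y1 y2 Kx Ky.
  have -> : x1 * y1 - x2 * y2 = y1 * (x1 - x2) + x2 * (y1 - y2) by ring.
  by apply: in_spanD; apply: in_spanM.
- by [].
Qed.

Hypothesis localP : forall s, in_span s \/ exists t, s * t = 1.
Hypothesis properP : ~ in_span 1.

(** Determinants only depend on the entries modulo the maximal ideal, so the
determinant of 1 - N is a unit and the adjugate provides the inverse. *)
Lemma local_invertible n (N : 'M[R]_n) :
  (forall i j, in_span (N i j)) -> exists W, (1%:M - N) *m W = 1%:M.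
Proof.
move=> NP; have [dP|[t dt]] := localP (\det (1%:M - N)).
  case: properP; rewrite -(subrK (\det (1%:M - N)) 1).
  apply: in_spanD => //; rewrite -{1}(det1 R n); apply: in_span_det => i j.
  by rewrite !mxE opprB addrC subrK.
exists (t *: \adj (1%:M - N)).
by rewrite -scalemxAr mul_mx_adj -mul_scalar_mx -scalar_mxM mulrC dt.
Qed.

(** This is linear algebra over the residue field: a map e that vanishes on the
kernel of d factors through d.  Eliminating the columns of d one by one, with a
unit as pivot, avoids forming that field. *)
Lemma local_factor n p m (d : 'M[R]_(n, m)) (e : 'M_(n, p)) :
  (forall v : 'rV_n, (forall i j, in_span ((v *m d) i j)) ->
     forall i j, in_span ((v *m e) i j)) ->
  exists C, forall i j, in_span ((e - d *m C) i j).
Proof.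
elim: m d e => [|m IHm] d e de.
  exists 0 => i j; rewrite mulmx0 subr0.
  have := de (delta_mx 0 i); rewrite -!rowE => /(_ _ 0 j).
  by rewrite mxE; apply=> ? [].
rewrite -[m.+1]/(1 + m)%N in d de *.
pose c := lsubmx d; pose d1 := rsubmx d.
have dE : d = row_mx c d1 by rewrite hsubmxK.
have dC C0 C1 : d *m col_mx C0 C1 = c *m C0 + d1 *m C1.
  by rewrite dE mul_row_col.
have vd (v : 'rV_n) : v *m c = 0 \/ (forall i j, in_span ((v *m c) i j)) ->
    (forall i j, in_span ((v *m d1) i j)) ->
    forall i j, in_span ((v *m d) i j).
  move=> vc vd1 i j; rewrite dE mul_mx_row mxE.
  case: split => // k; case: vc => [->|//]; rewrite mxE; exact: in_span0.
have [cP|/existsNP[r cr]] := pselect (forall i, in_span (c i 0)).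
  have [|C1 C1P] := IHm d1 e.
    move=> v vd1; apply: de; apply: vd => //; right.
    by apply: in_span_mulmx => i j; rewrite ord1.
  by exists (col_mx 0 C1) => i j; rewrite dC mulmx0 add0r.
have [//|[t ct]] := localP (c r 0).
(* P projects onto the kernel of the first column c. *)
pose P : 'M_n := 1%:M - t *: (c *m delta_mx 0 r).
have Pc : P *m c = 0.
  rewrite mulmxBl mul1mx -scalemxAl -mulmxA -rowE.
  have -> : row r c = (c r 0)%:M by apply/matrixP=> i j; rewrite !mxE !ord1.
  by rewrite mul_mx_scalar scalerA mulrC ct scale1r subrr.
have [|C1 C1P] := IHm (P *m d1) (P *m e).
  move=> v; rewrite !mulmxA => vd1; apply: de; apply: vd => //; left.
  by rewrite -mulmxA Pc mulmx0.
pose X := e - d1 *m C1.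
exists (col_mx (t *: (delta_mx 0 r *m X)) C1) => i j; rewrite dC.
have <- : P *m e - P *m d1 *m C1 =
  e - (c *m (t *: (delta_mx 0 r *m X)) + d1 *m C1); last by [].
rewrite -mulmxA -mulmxBr -/X mulmxBl mul1mx -scalemxAl -scalemxAr -mulmxA.
by rewrite opprD addrA addrAC.
Qed.

End Local.

Section Act.
Variables (R : comNzRingType) (V : lmodType R).

(** The action of A, on the right, on a row of elements of V: the map V^m -> V^n
obtained by tensoring with V. *)
Definition act m n (A : 'M[R]_(m, n)) (x : 'I_m -> V) : 'I_n -> V :=
  fun j => \sum_i A i j *: x i.

Lemma act_mul m n p (A : 'M[R]_(m, n)) (B : 'M_(n, p)) x k :
  act (A *m B) x k = act B (act A x) k.
Proof.
rewrite /act; under eq_bigr do rewrite mxE scaler_suml.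
rewrite exchange_big; apply: eq_bigr => i _; rewrite scaler_sumr.
by apply: eq_bigr => j _; rewrite scalerA mulrC.
Qed.

Lemma act_addmx m n (A B : 'M[R]_(m, n)) x k :
  act (A + B) x k = act A x k + act B x k.
Proof.
by rewrite -big_split; apply: eq_bigr => i _; rewrite mxE scalerDl.
Qed.

Lemma act1 m x (k : 'I_m) : act 1%:M x k = x k.
Proof.
rewrite /act (bigD1 k) //= mxE eqxx scale1r big1 ?addr0 // => i ik.
by rewrite mxE (negPf ik) scale0r.
Qed.

Lemma act0 m n x (k : 'I_n) : act (0 : 'M_(m, n)) x k = 0.
Proof. by apply: big1 => i _; rewrite mxE scale0r. Qed.

Lemma actB m n (A : 'M[R]_(m, n)) x y k :
  act A (fun i => x i - y i) k = act A x k - act A y k.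
Proof. by rewrite -sumrB; apply: eq_bigr => i _; rewrite scalerBr. Qed.

Lemma actZ m n (A : 'M[R]_(m, n)) b x k :
  act A (fun i => b *: x i) k = b *: act A x k.
Proof.
by rewrite scaler_sumr; apply: eq_bigr => i _; rewrite !scalerA mulrC.
Qed.

Variable U : V -> Prop.
(** Quotients V/U are never formed: the homology of a complex tensored with V/U is
expressed by congruences modulo U between rows of elements of V. *)
Record submodule : Prop := Submodule {
  subm0 : U 0;
  submZD : forall b x y, U x -> U y -> U (b *: x + y) }.

Hypothesis subU : submodule.

Lemma submD x y : U x -> U y -> U (x + y).
Proof. by rewrite -{2}[x]scale1r; apply: submZD. Qed.

Lemma submZ b x : U x -> U (b *: x).
Proof. by rewrite -[b *: x]addr0 => Ux; apply: submZD (subm0 subU). Qed.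

Lemma submN x : U x -> U (- x).
Proof. by rewrite -scaleN1r; apply: submZ. Qed.

Lemma submB x y : U x -> U y -> U (x - y).
Proof. by move=> Ux /submN; apply: submD. Qed.

Lemma submBC x y : U (x - y) -> U (y - x).
Proof. by rewrite -opprB => /submN; rewrite opprK. Qed.

Lemma subm_sum (I : finType) (F : I -> V) :
  (forall i, U (F i)) -> U (\sum_i F i).
Proof. by move=> FU; apply: big_ind => //; [apply: subm0|apply: submD]. Qed.

Lemma subm_trans y x z : U (x - y) -> U (y - z) -> U (x - z).
Proof. by move=> /submD/[apply]; rewrite addrA subrK. Qed.

Lemma subm_act m n (A : 'M[R]_(m, n)) x :
  (forall i, U (x i)) -> forall k, U (act A x k).
Proof. by move=> xU k; apply: subm_sum => i; apply: submZ. Qed.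

Lemma subm_actB m n (A : 'M[R]_(m, n)) x y :
  (forall i, U (x i - y i)) -> forall k, U (act A x k - act A y k).
Proof. by move=> xy k; rewrite -actB; apply: subm_act. Qed.

End Act.

(** * The acyclicity lemma over a local ring *)

(** Exactness at position j+1 of the complex tensored with V/U. *)
Definition acyclic_mod (R : comNzRingType) n (d : forall j, 'M[R]_(n j.+1, n j))
    (V : lmodType R) (U : V -> Prop) j :=
  forall x : 'I_(n j.+1) -> V, (forall k, U (act (d j) x k)) ->
  exists w, forall k, U (x k - act (d j.+1) w k).

Section Shift.
Variables (R : comNzRingType) (g : nat) (a : 'I_g -> R).
Variables (V : lmodType R) (U : V -> Prop).
Hypothesis subU : submodule U.
Hypothesis no_socle : forall v, (forall k, U (a k *: v)) -> U v.

(** The quotient of V^g by this submodule is the cokernel of the map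
V/U -> (V/U)^g, v |-> (a_k v).  Let the a_k generate the maximal ideal of a local
ring.  When V/U has no socle this map is injective; it induces 0 on every Ext out
of the residue field, so that the depth of the cokernel is one less than that of
V/U.  It plays the part that V/xV has for
a regular element x. *)
Definition koszul_mod (f : {ffun 'I_g -> V}) :=
  exists v, forall k, U (f k - a k *: v).

Lemma koszul_sub : submodule koszul_mod.
Proof.
split=> [|b f f' [v fv] [v' fv']].
  by exists 0 => k; rewrite ffunE scaler0 subrr; apply: subm0 subU.
exists (b *: v + v') => k; rewrite !ffunE scalerDr scalerA mulrC -scalerA.
by rewrite opprD addrACA -scalerBr; apply: submZD.
Qed.

Lemma act_ffun m n (A : 'M[R]_(m, n)) (x : 'I_m -> {ffun 'I_g -> V}) i k :
  act A x i k = act A (fun j => x j k) i.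
Proof. by rewrite /act sum_ffunE; apply: eq_bigr => j _; rewrite ffunE. Qed.

Variables (n : nat -> nat) (d : forall j, 'M[R]_(n j.+1, n j)).
Hypothesis dd : is_complex d.

(** The long exact sequence of 0 -> V/U -> (V/U)^g -> V' -> 0, where V' is the
cokernel, shows that exactness for V' at a position follows from exactness for
V/U there and one position to the right. *)
Lemma koszul_acyclic j : acyclic_mod d U j -> acyclic_mod d U j.+1 ->
  acyclic_mod d koszul_mod j.+1.
Proof.
move=> exj exj1 x /choice[v xv].
have [|y vy] := exj v.
  move=> l; apply: no_socle => k; rewrite -actZ.
  have dx : act (d j) (act (d j.+1) (fun i => x i k)) l = 0.
    by rewrite -act_mul dd act0.
  rewrite -[act _ _ _]subr0 -dx; apply: subm_actB => // i.
  by apply: submBC => //; have := xv i k; rewrite act_ffun.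
have /choice[w xw] k : exists w, forall i,
    U (x i k - a k *: y i - act (d j.+2) w i).
  apply: exj1 => l; rewrite actB actZ.
  apply: (@subm_trans _ _ _ subU (a k *: v l)); last first.
    by rewrite -scalerBr; apply: submZ.
  by have := xv l k; rewrite act_ffun.
exists (fun i => [ffun k => w k i]) => i; exists (y i) => k.
rewrite !ffunE act_ffun addrAC.
by under [act _ _ _]eq_bigr do rewrite ffunE.
Qed.

(** The connecting map of 0 -> V/U -> (V/U)^g -> V' -> 0 ends in H_j(V/U), and its
image is the socle, the kernel of the multiplications by all a_k.  So a nonzero
socle class lifts to a nonzero class for V' one position to the left.  The lift
is again killed by all a_l because the complex is exact at its position. *)
Lemma koszul_class j z : acyclic_mod d U j.+1 ->
  (forall k, U (act (d j) z k)) ->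
  (forall l, exists w, forall k, U (a l *: z k - act (d j.+1) w k)) ->
  (exists w, forall k, U (z k - act (d j.+1) w k)) \/
  exists z', [/\ forall k, koszul_mod (act (d j.+1) z' k),
    forall l, exists w, forall k, koszul_mod (a l *: z' k - act (d j.+2) w k) &
    ~ exists w, forall k, koszul_mod (z' k - act (d j.+2) w k)].
Proof.
move=> exj1 zc /choice[w zw].
have [|nz] := pselect (exists w, forall k, U (z k - act (d j.+1) w k)).
  by left.
right; exists (fun i => [ffun k => w k i]); split=> [i|l|[y]].
- exists (z i) => k; rewrite act_ffun; apply: submBC => //.
  by under [act _ _ _]eq_bigr do rewrite ffunE.
- have /choice[y wy] k : exists y, forall i,
      U (a l *: w k i - a k *: w l i - act (d j.+2) y i).
    apply: exj1 => i; rewrite actB !actZ.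
    have -> : a l *: act (d j.+1) (w k) i - a k *: act (d j.+1) (w l) i =
      a k *: (a l *: z i - act (d j.+1) (w l) i) -
      a l *: (a k *: z i - act (d j.+1) (w k) i).
      rewrite !scalerBr !(scalerA _ _ (z i)) [a l * a k]mulrC.
      by rewrite opprB [RHS]addrC addrA subrK.
    by apply: submB => //; apply: submZ.
  exists (fun i => [ffun k => y k i]) => i; exists (w l i) => k.
  rewrite !ffunE act_ffun addrAC.
  by under [act _ _ _]eq_bigr do rewrite ffunE.
- move=> /choice[v wv]; case: nz; exists v => i.
  apply: no_socle => k; rewrite scalerBr.
  apply: (@subm_trans _ _ _ subU (act (d j.+1) (w k) i)) => //.
  rewrite -actZ -[act _ (w k) i]subr0.
  have <- : act (d j.+1) (act (d j.+2) (fun i => y i k)) i = 0.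
    by rewrite -act_mul dd act0.
  rewrite -actB; apply: subm_actB => // i'.
  by have := wv i' k; rewrite !ffunE act_ffun.
Qed.

End Shift.

Section LocalAcyclicity.
Variables (R : comNzRingType) (g : nat) (a : 'I_g -> R).
Hypothesis localP : forall s, in_span a s \/ exists t, s * t = 1.
Hypothesis properP : ~ in_span a 1.
Variable n : nat -> nat.

(** The inequality of Auslander and Buchsbaum: a free syzygy beyond the depth
splits off.  Tensoring a vector v with the socle element u tests the entries of
its image modulo the maximal ideal, since s u is zero in V/U exactly for s in that
ideal.  So exactness modulo U says that the idempotent e that kills the boundaries
factors through the differential modulo the maximal ideal; such a factorization
lifts. *)
Lemma socle_contracts (d : forall j, 'M[R]_(n j.+1, n j)) (dd : is_complex d)
    (V : lmodType R) (U : V -> Prop) (subU : submodule U) (u : V) j :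
  ~ U u -> (forall k, U (a k *: u)) -> acyclic_mod d U j ->
  contracts 1 d j.+1 -> contracts 1 d j.
Proof.
move=> nUu auU exj [C0 [D sj1]].
have inU s : in_span a s -> U (s *: u).
  move=> [c ->]; rewrite scaler_suml; apply: subm_sum => // k.
  by rewrite -scalerA; apply: submZ.
have Uin s : U (s *: u) -> in_span a s.
  have [//|[t st]] := localP s; move=> /(submZ subU t).
  by rewrite scalerA mulrC st scale1r.
(* e is idempotent, and its kernel is the module of boundaries. *)
have [e eE] : exists e, e = 1%:M - D *m d j.+1 by exists (1%:M - D *m d j.+1).
have dDd : d j.+1 *m D *m d j.+1 = d j.+1.
  rewrite -[RHS]mul1mx sj1 mulmxDl -[C0 *m _ *m _]mulmxA dd mulmx0 add0r.
  by [].
have de : d j.+1 *m e = 0 by rewrite eE mulmxBr mulmx1 mulmxA dDd subrr.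
have ed : e *m d j = d j by rewrite eE mulmxBl mul1mx -mulmxA dd mulmx0 subr0.
have ee : e *m e = e by rewrite {1}eE mulmxBl mul1mx -mulmxA de mulmx0 subr0.
have [|C CP] := local_factor localP (d := d j) (e := e).
  move=> v vd i k; rewrite ord1 {i}; apply: Uin.
  have actu m (w : 'rV_m) p (A : 'M_(m, p)) l :
      act A (fun i => w 0 i *: u) l = (w *m A) 0 l *: u.
    rewrite mxE scaler_suml; apply: eq_bigr => i _.
    by rewrite scalerA mulrC.
  have [|w vw] := exj (fun i => v 0 i *: u).
    by move=> l; rewrite actu; apply: inU.
  rewrite -actu -[act _ _ _]subr0.
  have <- : act e (act (d j.+1) w) k = 0 by rewrite -act_mul de act0.
  by apply: subm_actB.
pose N := e *m (e - d j *m C) *m e.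
have [|W NW] := local_invertible localP properP (N := N).
  by apply: in_span_mulmxr => i k; apply: in_span_mulmx.
have eN : e *m (1%:M - N) = d j *m (C *m e).
  have -> : N = e - d j *m (C *m e).
    by rewrite /N mulmxBr ee (mulmxA e (d j)) ed mulmxBl ee -mulmxA.
  by rewrite mulmxBr mulmx1 mulmxBr ee (mulmxA e (d j)) ed subKr.
exists D, (C *m e *m W).
by rewrite mulmxA -eN -mulmxA NW mulmx1 eE addrC subrK.
Qed.

Lemma contracts_class (d : forall j, 'M[R]_(n j.+1, n j))
    (V : lmodType R) (U : V -> Prop) (subU : submodule U) j :
  contracts 1 d j -> acyclic_mod d U j.
Proof.
move=> [C [D e1]] z zd; exists (act C z) => k.
rewrite -act_mul -{1}[z k]act1 e1 act_addmx addrC addKr act_mul.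
exact: subm_act.
Qed.

Variables (A B : forall j, 'M[R]_(n j.+1, n j)).
Hypotheses (AA : is_complex A) (BB : is_complex B).
Hypothesis AB : forall j, contracts 1 A j -> contracts 1 B j.
Variable J : nat.
Hypothesis A_J : forall j, (J <= j)%N -> contracts 1 A j.

(** Both complexes live on the same free modules; A carries the exactness and B the
class, and every splitting of A is one of B.  The induction runs over the distance
from the class to the range where A is known to split, and r counts the cokernels
taken so far: A is then exact modulo U from index r on, while the class started at
an index of at least 0 and has been moved r steps as well. *)
Lemma no_socle_class_mod m : forall r j (V : lmodType R) (U : V -> Prop) z,
  (J <= j + m)%N -> (r <= j)%N -> submodule U ->
  (forall k, (r <= k)%N -> acyclic_mod A U k) ->
  (forall k, (j < k)%N -> acyclic_mod B U k) ->
  (forall k, U (act (B j) z k)) ->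
  (forall l, exists w, forall k, U (a l *: z k - act (B j.+1) w k)) ->
  exists w, forall k, U (z k - act (B j.+1) w k).
Proof.
elim: m => [|m IHm] r j V U z Jj rj subU exA exB zB az.
  by apply: (contracts_class subU _ zB); apply: AB; apply: A_J; rewrite -[j]addn0.
have [[u [nUu aUu]]|/forallNP no_soc] :=
    pselect (exists u, ~ U u /\ forall k, U (a k *: u)).
  apply: (contracts_class subU _ zB); apply: AB.
  suff Ar i k : (r <= k)%N -> (J <= k + i)%N -> contracts 1 A k.
    by apply: (Ar J) => //; apply: leq_addl.
  elim: i k => [|i IHi] k ranks Jk; first by apply: A_J; rewrite -[k]addn0.
  apply: (socle_contracts AA subU nUu aUu (exA _ ranks)).
  by apply: IHi; rewrite ?addSnnS // ltnW.
have {}no_soc v : (forall k, U (a k *: v)) -> U v.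
  by move=> av; apply: contrapT => nUv; apply: (no_soc v).
have [//|[z' [z'B az' nz']]] := koszul_class subU no_soc BB (exB _ (ltnSn j)) zB az.
case: nz'; apply: (IHm r.+1 j.+1) => //.
- by rewrite addSnnS.
- exact: koszul_sub.
- by case=> // k ranks; apply: koszul_acyclic => //; apply: exA => //; apply: ltnW.
- move=> [//|k] jk; apply: koszul_acyclic => //; apply: exB => //.
  exact: ltnW.
Qed.

End LocalAcyclicity.

Lemma act_row (S : comNzRingType) m k (A : 'M[S]_(m, k)) (x : 'I_m -> S^o) i :
  act A x i = ((\row_j x j) *m A) 0 i.
Proof. by rewrite mxE; apply: eq_bigr => j _; rewrite mxE; apply: mulrC. Qed.

Lemma acyclic_modP (S : comNzRingType) n' (c : forall j, 'M[S]_(n' j.+1, n' j)) j :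
  (forall v : 'rV_(n' j.+1), v *m c j = 0 -> exists w, v = w *m c j.+1) ->
  acyclic_mod c (fun x : S^o => x = 0) j.
Proof.
move=> exc x xc; have [|w xw] := exc (\row_k x k).
  by apply/rowP=> k; rewrite -act_row xc mxE.
exists (fun i => w 0 i) => k; rewrite act_row.
have -> : \row_j0 (w 0 j0 : S^o) = w by apply/rowP=> i; rewrite mxE.
by rewrite -xw mxE subrr.
Qed.

(** The case V = S, U = 0 and r = 0 of [no_socle_class_mod], for row vectors. *)
Lemma no_socle_class (S : comNzRingType) g (a : 'I_g -> S) n
    (A B : forall j, 'M[S]_(n j.+1, n j)) J j (v : 'rV_(n j.+1)) :
  (forall s, in_span a s \/ exists t, s * t = 1) -> ~ in_span a 1 ->
  is_complex A -> is_complex B -> acyclic A ->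
  (forall j, contracts 1 A j -> contracts 1 B j) ->
  (forall j, (J <= j)%N -> contracts 1 A j) ->
  (forall k (u : 'rV_(n k.+1)), (j < k)%N -> u *m B k = 0 ->
     exists w, u = w *m B k.+1) ->
  v *m B j = 0 -> (forall l, exists w, a l *: v = w *m B j.+1) ->
  exists w, v = w *m B j.+1.
Proof.
move=> localS properS AA BB exA AB A_J exB vB av.
have row_id m (u : 'rV[S]_m) : \row_k (u 0 k : S^o) = u.
  by apply/rowP=> k; rewrite mxE.
have [|||||||w vw] := @no_socle_class_mod _ _ _ localS properS _ _ _ AA BB AB
  J A_J J 0 j (S^o) (fun x => x = 0) (fun i => v 0 i).
- exact: leq_addl.
- by [].
- by split=> // b x y -> ->; rewrite scaler0 addr0.
- by move=> k _; apply: acyclic_modP => u; apply: exA.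
- by move=> k jk; apply: acyclic_modP => u; apply: exB.
- by move=> k; rewrite act_row row_id vB mxE.
- move=> l; have [w e] := av l; exists (fun i => w 0 i) => k.
  by rewrite act_row row_id -e mxE subrr.
exists (\row_k w k); apply/rowP=> k; rewrite -act_row.
by apply/eqP; rewrite -subr_eq0; apply/eqP/vw.
Qed.

(** * Localization at a prime *)

Section Localization.
Variables (R : comNzRingType) (P : prime_idealr R).

Definition mk_denom s (sP : s \notin P) : denom P := exist _ s sP.

Lemma prod_notin (I : Type) (r : seq I) (p : pred I) (s : I -> R) :
  (forall i, s i \notin P) -> \prod_(i <- r | p i) s i \notin P.
Proof.
move=> sP; apply: (big_ind (fun x => x \notin P)) => //.
  by rewrite idealr1.
by move=> x y xP yP; rewrite prime_idealrM negb_or xP.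
Qed.

Lemma mul_notin x y : x \notin P -> y \notin P -> x * y \notin P.
Proof. by move=> xP yP; rewrite prime_idealrM negb_or xP. Qed.

Lemma common_denom (M : lmodType R) (I : finType) (y : I -> loc_mod P M) :
  exists (s : denom P) x, forall i, y i = frac (x i) s.
Proof.
pose sP := prod_notin (index_enum I) xpredT (fun i => valP (repr (y i)).2).
exists (mk_denom sP).
exists (fun i => (\prod_(j | j != i) val (repr (y j)).2) *: (repr (y i)).1) => i.
rewrite -{1}(frac_repr (y i)); apply: frac_eq; rewrite scalerA.
by rewrite [in LHS]/val /= (bigD1 i).
Qed.

Definition to_loc (x : R) : loc_ring P := frac (x : R^o) (denom1 P).

Lemma to_loc_is_zmod_morphism : zmod_morphism to_loc.
Proof.
have D x y : to_loc (x + y) = to_loc x + to_loc y.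
  by rewrite /to_loc -[LHS](@add_frac_same _ P R^o x y).
move=> x y; apply/(canRL (addrK _)).
by rewrite -D subrK.
Qed.

Lemma to_loc_is_monoid_morphism : monoid_morphism to_loc.
Proof.
split=> // x y; symmetry; apply: etrans (loc_mod_scale (M := R^o) x _ y _) _.
by apply: frac_eq; rewrite !val_denomM !mulr1.
Qed.

HB.instance Definition _ :=
  GRing.isZmodMorphism.Build R (loc_ring P) to_loc to_loc_is_zmod_morphism.
HB.instance Definition _ :=
  GRing.isMonoidMorphism.Build R (loc_ring P) to_loc to_loc_is_monoid_morphism.

Lemma to_loc_scale (M : lmodType R) a (x : M) s :
  to_loc a *: (frac x s : loc_mod P M) = frac (a *: x) s.
Proof.
rewrite /to_loc loc_mod_scale; apply: frac_eq.
by rewrite val_denomM val_denom1 mul1r.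
Qed.

Lemma to_loc_eq x y : to_loc x = to_loc y <-> exists2 w, w \notin P & w * x = w * y.
Proof.
split=> [/fracP[w]|[w wP e]].
  by rewrite !val_denom1 !mulr1 => e; exists (val w); first exact: (valP w).
by apply/fracP; exists (mk_denom wP); rewrite !val_denom1 !mulr1.
Qed.

Lemma to_loc_unit s : s \notin P -> exists t, to_loc s * t = 1.
Proof.
move=> sP; exists (frac (1 : R^o) (mk_denom sP)).
apply: etrans (to_loc_scale (M := R^o) s 1 (mk_denom sP)) _.
by apply: frac_eq; rewrite val_denom1 scale1r.
Qed.

Lemma to_loc_frac (x : R) s : to_loc (val s) * (frac (x : R^o) s : loc_ring P) = to_loc x.
Proof.
apply: etrans (to_loc_scale (M := R^o) (val s) x s) _.
by apply: frac_eq; rewrite val_denom1 scale1r.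
Qed.

Lemma to_loc_div (u : loc_ring P) : exists x s t,
  [/\ s \notin P, to_loc s * t = 1 & u = t * to_loc x].
Proof.
elim/fracW: u => x s; have [t st] := to_loc_unit (valP s).
exists x, (val s), t; split=> //; first exact: (valP s).
by rewrite -(to_loc_frac x s) mulrA [t * _]mulrC st mul1r.
Qed.

Lemma to_loc_surj (m n : nat) (A : 'M[loc_ring P]_(m, n)) :
  exists (s : R) (A' : 'M[R]_(m, n)), s \notin P /\ to_loc s *: A = map_mx to_loc A'.
Proof.
have [s [x e]] := common_denom (fun ij : 'I_m * 'I_n => A ij.1 ij.2 : loc_mod P R^o).
exists (val s), (\matrix_(i, j) x (i, j)); split; first exact: (valP s).
by apply/matrixP=> i j; rewrite !mxE (e (i, j)) to_loc_frac.
Qed.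

Lemma to_loc_mx_eq (m n : nat) (A B : 'M[R]_(m, n)) :
  map_mx to_loc A = map_mx to_loc B -> exists2 w, w \notin P & w *: A = w *: B.
Proof.
move=> /matrixP AB.
have /choice[w wP] (ij : 'I_m * 'I_n) :
    exists w, w \notin P /\ w * A ij.1 ij.2 = w * B ij.1 ij.2.
  have := AB ij.1 ij.2; rewrite !mxE => /to_loc_eq[w wP e].
  by exists w.
exists (\prod_ij w ij); first by apply: prod_notin => ij; case: (wP ij).
apply/matrixP=> i j; rewrite !mxE (bigD1 (i, j)) //= ![w _ * _]mulrC -!mulrA.
by have [_ /= ->] := wP (i, j).
Qed.

Lemma to_loc_mx_eq0 (m n : nat) (A : 'M[R]_(m, n)) :
  map_mx to_loc A = 0 -> exists2 w, w \notin P & w *: A = 0.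
Proof.
rewrite -(map_mx0 to_loc) => /to_loc_mx_eq[w wP e].
by exists w; rewrite // e scaler0.
Qed.

Variables (n : nat -> nat) (d : forall j, 'M[R]_(n j.+1, n j)).

Lemma map_complex (S : comNzRingType) (phi : {rmorphism R -> S}) :
  is_complex d -> is_complex (fun j => map_mx phi (d j)).
Proof. by move=> dd j; rewrite -map_mxM dd map_mx0. Qed.

Lemma map_contracts (S : comNzRingType) (phi : {rmorphism R -> S}) h j :
  contracts h d j -> contracts (phi h) (fun j => map_mx phi (d j)) j.
Proof.
move=> [C [D e]]; exists (map_mx phi C), (map_mx phi D).
by rewrite -!map_mxM -map_mxD -e map_scalar_mx.
Qed.

(** Exactness up to denominators is what localization sees; the weak form of the
hypothesis is needed for homology that is only known to vanish at P. *)
Lemma loc_exact (m l k : nat) (A : 'M[R]_(m, l)) (B : 'M[R]_(l, k)) :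
  (forall v : 'rV_l, v *m B = 0 ->
     exists2 s, s \notin P & exists w, s *: v = w *m A) ->
  forall v : 'rV_l, v *m map_mx to_loc B = 0 -> exists w, v = w *m map_mx to_loc A.
Proof.
move=> exAB v vB; have [s [v' [sP e]]] := to_loc_surj v.
have /to_loc_mx_eq0[w wP] : map_mx to_loc (v' *m B) = 0.
  by rewrite map_mxM -e -scalemxAl vB scaler0.
rewrite scalemxAl => /exAB[r rP [y wy]].
have [t] := to_loc_unit (mul_notin rP (mul_notin wP sP)); rewrite !rmorphM /= => st.
exists (t *: map_mx to_loc y); rewrite -scalemxAl -map_mxM -wy !map_mxZ -e.
by rewrite !scalerA -!mulrA mulrC st scale1r.
Qed.

Lemma loc_acyclic : acyclic d -> acyclic (fun j => map_mx to_loc (d j)).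
Proof.
move=> exd j; apply: loc_exact => v /exd[w e].
by exists 1; rewrite ?idealr1 //; exists w; rewrite scale1r.
Qed.

(** Clearing the denominators of a splitting over the localization yields a
homotopy for a multiplication by some h outside P. *)
Lemma loc_contracts j : contracts 1 (fun j => map_mx to_loc (d j)) j ->
  exists2 h, h \notin P & contracts h d j.
Proof.
move=> [C [D e]].
have [s [C' [sP eC]]] := to_loc_surj C; have [t [D' [tP eD]]] := to_loc_surj D.
have : map_mx to_loc ((s * t)%:M) = map_mx to_loc ((t *: C') *m d j.+1 + d j *m (s *: D')).
  rewrite map_scalar_mx map_mxD !map_mxM !map_mxZ -eC -eD -scalemx1 /=.
  rewrite e scalerDr -!scalemxAl -!scalemxAr !scalerA !rmorphM.
  by rewrite [to_loc t * _]mulrC.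
move=> /to_loc_mx_eq[w wP ew]; exists (w * (s * t)).
  by rewrite !mul_notin.
exists (w *: (t *: C')), (w *: (s *: D')).
by rewrite scalar_mxM mul_scalar_mx ew scalerDr scalemxAl scalemxAr.
Qed.

Lemma contracts_unit (S : comNzRingType) n' (d' : forall j, 'M[S]_(n' j.+1, n' j)) h t j :
  h * t = 1 -> contracts h d' j -> contracts 1 d' j.
Proof.
move=> ht [C [D e]]; exists (t *: C), (t *: D).
rewrite -scalemxAl -scalemxAr -scalerDr -e scale_scalar_mx mulrC.
by rewrite ht.
Qed.

Lemma contracts_loc h j : h \notin P -> contracts h d j ->
  contracts 1 (fun j => map_mx to_loc (d j)) j.
Proof.
by move=> /to_loc_unit[t ht] /(map_contracts to_loc); apply: contracts_unit ht.
Qed.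

Lemma loc_local g (a : 'I_g -> R) : (forall x, x \in P <-> in_span a x) ->
  (forall s, in_span (fun k => to_loc (a k)) s \/ exists t, s * t = 1) /\
  ~ in_span (fun k => to_loc (a k)) 1.
Proof.
move=> aP; split.
  move=> y; have [x [s [t [sP st e]]]] := to_loc_div y.
  have [/aP[c xc]|xP] := boolP (x \in P); [left|right].
    rewrite e xc; apply: in_spanM; exists (fun k => to_loc (c k)).
    by rewrite rmorph_sum; apply: eq_bigr => k _; rewrite rmorphM.
  have [u xu] := to_loc_unit xP; exists (u * to_loc s).
  by rewrite e mulrACA [t * u]mulrC mulrACA [u * _]mulrC xu mul1r [t * _]mulrC.
move=> [c c1].
have [s [c' [sP e]]] := to_loc_surj (\row_k c k).
have : to_loc s = to_loc (\sum_k c' 0 k * a k).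
  rewrite -[LHS]mulr1 c1 mulr_sumr rmorph_sum; apply: eq_bigr => k _.
  rewrite rmorphM mulrA; congr (_ * _).
  by move/matrixP: e => /(_ 0 k); rewrite !mxE.
move=> /to_loc_eq[w wP ew].
have : w * s \in P by rewrite ew idealMr //; apply/aP; exists (c' 0).
by rewrite (negPf (mul_notin wP sP)).
Qed.

End Localization.

(** * Noetherian rings and associated primes *)

Section IdealOfSubmodule.
Variables (R : comNzRingType) (I : R^o -> Prop).
Hypotheses (subI : submodule I) (I1 : ~ I 1).

Let S : R -> bool := fun x => `[< I x >].

Let S_ideal : idealr_closed S.
Proof.
split; first by apply/asboolP; apply: (subm0 subI).
  by apply/asboolPn.
by move=> b x y /asboolP Ix /asboolP Iy; apply/asboolP; apply: (submZD subI).
Qed.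

Lemma idealr_of_submodule : exists J : idealr R, forall x, x \in J <-> I x.
Proof.
pose J : idealr R := HB.pack S (isIdealr.Build R S S_ideal).
by exists J => x; split=> /asboolP.
Qed.

Lemma prime_idealr_of_submodule : (forall x y : R, I (x * y) -> I x \/ I y) ->
  exists q : prime_idealr R, forall x, x \in q <-> I x.
Proof.
move=> Iprime; have S_prime : prime_idealr_closed S.
  move=> x y /asboolP/Iprime[Ix|Iy]; apply/orP; [left|right]; exact/asboolP.
pose q : prime_idealr R := HB.pack S (isIdealr.Build R S S_ideal)
  (isPrimeIdealrClosed.Build R S S_prime).
by exists q => x; split=> /asboolP.
Qed.

End IdealOfSubmodule.

Lemma submodule_idealr (R : comNzRingType) (J : idealr R) :
  submodule (fun x : R^o => x \in J : Prop).
Proof.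
split=> [|b x y xJ yJ]; first exact: rpred0.
by rewrite rpredD // idealMr.
Qed.

Section Noetherian.
Variable R : comNzRingType.
Hypothesis noethR : noetherian R.

Lemma noeth_ideal (I : R^o -> Prop) : submodule I ->
  exists g (a : 'I_g -> R), forall x : R, I x <-> in_span a x.
Proof.
move=> subI; have [|g [a aP]] := noethR (I := fun x : R^o => `[< I x >]).
  split; first by apply/asboolP; apply: (subm0 subI).
  by move=> b x y /asboolP Ix /asboolP Iy; apply/asboolP; apply: (submZD subI).
by exists g, a => x; split=> [Ix|/aP/asboolP//]; apply/aP/asboolP.
Qed.

(** Induction on n: the first coordinates of the members of U form an ideal, and the
members with first coordinate 0 form a submodule of R^(n-1). *)
Lemma noeth_mx n (U : 'rV[R]_n -> Prop) : submodule U ->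
  exists k (B : 'M[R]_(k, n)), forall v, U v <-> exists w, v = w *m B.
Proof.
elim: n U => [|n IHn] U subU.
  exists 0, 0 => v; rewrite (_ : v = 0); last by apply/rowP=> -[].
  split=> _; last exact: subm0.
  by exists 0; rewrite mul0mx.
rewrite -[n.+1]/(1 + n)%N in U subU *.
have [|g [a aP]] := @noeth_ideal (fun x => exists2 v, U v & lsubmx v = x%:M).
  split; first by exists 0; rewrite ?linear0 ?raddf0; [exact: subm0|].
  move=> b x y [v Uv vx] [w Uw wy]; exists (b *: v + w); first exact: submZD.
  by rewrite linearP /= vx wy raddfD /= scale_scalar_mx.
have /choice[v vP] k : exists v, U v /\ lsubmx v = (a k)%:M.
  by have [v Uv vk] := (aP (a k)).2 (in_span_gen a k); exists v.
have [|k [B BP]] := IHn (fun v => U (row_mx 0 v)).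
  split; first by rewrite row_mx0; apply: subm0.
  move=> b x y Ux Uy.
  have -> : row_mx 0 (b *: x + y) = b *: row_mx 0 x + row_mx 0 y :> 'rV_(1 + n).
    by rewrite scale_row_mx add_row_mx scaler0 addr0.
  exact: submZD.
pose G := \matrix_k v k.
have UG (c : 'rV_g) : U (c *m G).
  have -> : c *m G = \sum_k c 0 k *: v k.
    by rewrite mulmx_sum_row; apply: eq_bigr => i _; rewrite rowK.
  by apply: subm_sum => // i; apply: submZ => //; case: (vP i).
exists (g + k)%N, (col_mx G (row_mx 0 B)) => x; split; last first.
  move=> [w ->]; rewrite -[w]hsubmxK mul_row_col mul_mx_row mulmx0.
  by apply: submD => //; apply/BP; exists (rsubmx w).
move=> Ux; have [|c cx] := (aP (lsubmx x 0 0)).1.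
  by exists x; rewrite // [LHS]mx11_scalar.
(* Subtracting members of U with the right first coordinates leaves a row
with first coordinate 0. *)
pose y := x - (\row_k c k) *m G.
have y0 : lsubmx y = 0.
  rewrite linearB /= -mulmx_lsub; apply/eqP; rewrite subr_eq0; apply/eqP.
  apply/matrixP=> i j; rewrite !ord1 cx mxE; apply: eq_bigr => k' _.
  by have /matrixP/(_ 0 0) := (vP k').2; rewrite !mxE eqxx mulr1n => <-.
have [|w wy] := (BP (rsubmx y)).1.
  by rewrite -y0 hsubmxK; apply: submB.
exists (row_mx (\row_k c k) w); rewrite mul_row_col mul_mx_row mulmx0 -wy -y0.
by rewrite hsubmxK addrC subrK.
Qed.

Lemma noeth_ker m n (A : 'M[R]_(m, n)) : exists k (B : 'M[R]_(k, m)),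
  B *m A = 0 /\ forall v : 'rV_m, v *m A = 0 -> exists w, v = w *m B.
Proof.
have [|k [B BP]] := @noeth_mx m (fun v => v *m A = 0).
  split; first exact: mul0mx.
  by move=> b x y x0 y0; rewrite mulmxDl -scalemxAl x0 y0 scaler0 addr0.
exists k, B; split=> [|v /BP//]; apply/row_matrixP=> i.
by rewrite row_mul row0; apply/BP; exists (delta_mx 0 i); rewrite -rowE.
Qed.

(** Otherwise an infinite strictly increasing chain could be chosen, whose union is
finitely generated, so that the generators would all occur at some stage. *)
Lemma noeth_max (T : Type) (F : T -> R^o -> Prop) (t0 : T) :
  (forall t, submodule (F t)) ->
  exists t, forall t', (forall x, F t x -> F t' x) -> forall x, F t' x -> F t x.
Proof.
move=> subF; apply: contrapT => /forallNP nmax.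
have /choice[f fP] t : exists t', (forall x, F t x -> F t' x) /\
    exists x, F t' x /\ ~ F t x.
  have /existsNP[t' /not_implyP[tt' /existsNP[x /not_implyP[tx t'x]]]] := nmax t.
  by exists t'; split => //; exists x.
pose c i := iter i f t0.
have c_mono i j x : (i <= j)%N -> F (c i) x -> F (c j) x.
  move=> /subnK<-; elim: (j - i)%N => // k IHk Fx.
  by rewrite addSn; apply: (fP _).1; apply: IHk.
have [|g [a aP]] := @noeth_ideal (fun x => exists i, F (c i) x).
  split; first by exists 0; apply: subm0.
  move=> b x y [i Fx] [j Fy]; exists (maxn i j); apply: submZD => //.
    exact: c_mono (leq_maxl _ _) _.
  exact: c_mono (leq_maxr _ _) _.
have /choice[h hP] k : exists i, F (c i) (a k) by apply/aP/in_span_gen.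
pose N := \max_k h k.
have [_ [x [xF nxF]]] := fP (c N); case: nxF.
have [|d ->] := (aP x).1; first by exists N.+1.
apply: (subm_sum (subF (c N))) => k; apply: (submZ (subF (c N)) (d k)).
by apply: c_mono (hP k); apply: leq_bigmax.
Qed.

(** The hypothesis says that z is nonzero in V/U localized at q; the conclusion
provides a multiple of z whose annihilator in V/U is a prime contained in q.  To
stay inside q, the ideals that are maximized are the contractions to R of the
annihilators over the localization at q; finite generation of the one obtained
then allows clearing denominators. *)
Lemma assoc_prime (V : lmodType R) (U : V -> Prop) (q : prime_idealr R) z :
  submodule U -> (forall s, s \notin q -> ~ U (s *: z)) ->
  exists a (q' : prime_idealr R), (forall x, x \in q' -> x \in q) /\
    forall b, b \in q' <-> U (b *: (a *: z)).
Proof.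
move=> subU nz.
pose T := {a : R | forall s, s \notin q -> ~ U (s *: (a *: z))}.
pose F a b := exists2 s, s \notin q & U (s *: (b *: (a *: z))).
have subF a : submodule (F a : R^o -> Prop).
  split; first by exists 1; rewrite ?idealr1 // scale0r scaler0; apply: subm0.
  move=> b x y [s sq Ux] [t tq Uy]; exists (s * t); first exact: mul_notin.
  have -> : (s * t) *: ((b *: (x : R^o) + y) *: (a *: z)) =
    (b * t) *: (s *: (x *: (a *: z))) + s *: (t *: (y *: (a *: z))).
    rewrite !scalerA -scalerDl; congr (_ *: _).
    by rewrite -[b *: _]/(b * _); ring.
  by apply: submZD => //; apply: submZ.
have T1 : forall s, s \notin q -> ~ U (s *: (1 *: z)).
  by move=> s; rewrite scale1r; apply: nz.
have [[a aT] amax] := @noeth_max T (fun t => F (sval t)) (exist _ 1 T1)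
  (fun t => subF (sval t)).
rewrite /= in amax.
have F1 : ~ F a 1.
  by move=> [s sq]; rewrite scale1r; apply: aT.
have [|q' q'P] := prime_idealr_of_submodule (subF a) F1.
  move=> x y [s sq Uxy]; have [|nFx] := pselect (F a x); [by left | right].
  have xT : forall s, s \notin q -> ~ U (s *: (x * a *: z)).
    by move=> t tq Ut; case: nFx; exists t => //; rewrite (scalerA x a z).
  apply: (amax (exist _ (x * a) xT)) => /=.
    move=> b [t tq Ut]; exists t => //.
    have -> : t *: (b *: (x * a *: z)) = x *: (t *: (b *: (a *: z))).
      by rewrite !scalerA; congr (_ *: _); ring.
    exact: submZ.
  exists s => //; rewrite (_ : y *: _ = x * y *: (a *: z)) //.
  by rewrite !scalerA; congr (_ *: _); ring.
have q'q x : x \in q' -> x \in q.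
  by move=> /q'P[s sq Us]; apply: contraT => xq; case: (aT (s * x));
     rewrite ?mul_notin // -scalerA.
have [g [c cP]] := noeth_ideal (subF a).
have /choice[s sP] k : exists s, s \notin q /\ U (s *: (c k *: (a *: z))).
  by have [s sq Us] : F a (c k) by [apply/cP/in_span_gen]; exists s.
have sq : \prod_k s k \notin q by apply: prod_notin => k; case: (sP k).
exists (\prod_k s k * a), q'; split=> // b; split=> [/q'P/cP[d ->]|Ub].
  rewrite scaler_suml; apply: subm_sum => // k.
  have -> : d k * c k *: (\prod_i s i * a *: z) =
    (d k * \prod_(i | i != k) s i) *: (s k *: (c k *: (a *: z))).
    by rewrite !scalerA; congr (_ *: _); rewrite [in LHS](bigD1 k) //=; ring.
  by apply: submZ => //; case: (sP k).
apply/q'P; exists (\prod_k s k) => //.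
rewrite (_ : _ *: _ = b *: (\prod_k s k * a *: z)) //.
by rewrite !scalerA; congr (_ *: _); ring.
Qed.

End Noetherian.

(** A non-unit s outside m would lie in some ideal maximal among the proper ones
containing s, which by uniqueness has to be m.  The complement of m is then made
of units, so that m is prime. *)
Lemma local_ring_unit (R : comNzRingType) : noetherian R -> local_ring R ->
  exists m : prime_idealr R, forall s, s \notin m -> exists t, s * t = 1.
Proof.
move=> noethR [m m_max m_uniq].
have m_unit s : s \notin m -> exists t, s * t = 1.
  move=> sm; apply: contrapT => /forallNP ns.
  pose T := {I : R^o -> Prop | [/\ submodule I, ~ I 1 & I s]}.
  have sP : [/\ submodule (fun x : R^o => exists t, x = s * t),
     ~ (exists t, 1 = s * t) & exists t, s = s * t].
    split; last by exists 1; rewrite mulr1.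
      split; first by exists 0; rewrite mulr0.
      move=> b _ _ [t ->] [u ->]; exists (b * t + u).
      by rewrite mulrDr [b *: _]mulrCA.
    by move=> [t /esym/ns].
  have [||[I [subI I1 Is]] Imax] := @noeth_max R noethR T (fun I => sval I).
    exact: (exist _ _ sP).
    by move=> [I [subI]].
  rewrite /= in Imax.
  have [J JP] := idealr_of_submodule subI I1.
  have J_max : maximal_ideal J.
    move=> K JK x; apply/idP/idP => [xK|/JK//]; apply/JP.
    have KP : [/\ submodule (fun x : R^o => x \in K : Prop), ~ (1 \in K) & s \in K].
      split; [exact: submodule_idealr | by rewrite idealr1 | exact/JK/JP].
    by apply: (Imax (exist _ _ KP)) xK => y Iy; apply/JK/JP.
  by move: sm; rewrite -(m_uniq J J_max) => /negP; apply; apply/JP.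
have [||q qP] := prime_idealr_of_submodule (submodule_idealr m).
- by rewrite idealr1.
- move=> x y xym; have [xm|/m_unit[t xt]] := boolP (x \in m); first by left.
  by right; rewrite -[y]mul1r -xt mulrAC mulrC idealMr.
exists q => s sq; apply: m_unit; apply: contra sq => sm.
exact/qP.
Qed.

(** * Frobenius preserves resolutions of finite length *)

Section PeskineSzpiro.
Variables (R : comNzRingType) (p : nat) (pcharR : p \in [pchar R]) (e : nat).
Hypothesis noethR : noetherian R.
Local Notation f := (frob_iter e pcharR).

Lemma pchar_loc (q : prime_idealr R) : p \in [pchar (loc_ring q)].
Proof.
have /andP[p_pr /eqP p0] := pcharR; apply/andP; split=> //.
by rewrite -(rmorph_nat (to_loc q)) p0 rmorph0.
Qed.

Variables (n : nat -> nat) (d : forall j, 'M[R]_(n j.+1, n j)).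
Hypotheses (dd : is_complex d) (exd : acyclic d).

Lemma frob_to_loc (q : prime_idealr R) m k (A : 'M[R]_(m, k)) :
  map_mx (to_loc q) (map_mx f A) =
  map_mx (frob_iter e (pchar_loc q)) (map_mx (to_loc q) A).
Proof. by apply/matrixP=> i j; rewrite !mxE /frob_iter rmorphXn. Qed.

(** Descending induction on the position.  If homology at j+1 survives localization
at q while it vanishes there at all later positions, take a class with a prime
annihilator q' contained in q.  Over the localization at q' it is killed by the
maximal ideal, and later homology still vanishes because q' is smaller than q, so
that the class is zero by the local statement: a contradiction. *)
Lemma frob_acyclic_loc (q : prime_idealr R) J :
  (forall j, (J <= j)%N -> exists2 h, h \notin q & contracts h d j) ->
  forall j (v : 'rV_(n j.+1)), v *m map_mx f (d j) = 0 ->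
  exists2 s, s \notin q & exists w, s *: v = w *m map_mx f (d j.+1).
Proof.
move=> dJ j; move: {2}J (leq_addl j J) => m.
elim: m j => [|m IHm] j Jj v vd.
  have [|h hq] := dJ j; first by rewrite -[j]addn0.
  move=> /(map_contracts f)[C [D e1]]; exists (f h).
    rewrite /frob_iter /=; elim: (p ^ e)%N => [|k IHk]; first by rewrite idealr1.
    by rewrite exprS mul_notin.
  exists (v *m C); rewrite -mul_mx_scalar e1 mulmxDr (mulmxA v (map_mx _ _)) vd.
  by rewrite mul0mx addr0 mulmxA.
apply: contrapT => nv.
pose U (u : 'rV_(n j.+1)) := exists w, u = w *m map_mx f (d j.+1).
have subU : submodule U.
  split; first by exists 0; rewrite mul0mx.
  by move=> b x y [w ->] [w' ->]; exists (b *: w + w'); rewrite mulmxDl scalemxAl.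
have [|a [q' [q'q q'P]]] := assoc_prime noethR (U := U) (q := q) (z := v) subU.
  by move=> s sq Us; case: nv; exists s.
have nq s : s \notin q -> s \notin q' by apply: contra => /q'q.
have [g [c cP]] := noeth_ideal noethR (submodule_idealr q').
have [localS properS] := @loc_local R q' g c cP.
pose A i := map_mx (to_loc q') (d i); pose B i := map_mx (to_loc q') (map_mx f (d i)).
have [||||||||w vw] := @no_socle_class _ _ (fun k => to_loc q' (c k)) n A B J j
  (map_mx (to_loc q') (a *: v)) localS properS.
- exact: map_complex.
- exact/map_complex/map_complex.
- exact: loc_acyclic.
- move=> i; rewrite /A /B => /(map_contracts (frob_iter e (pchar_loc q'))).
  rewrite rmorph1; case=> C [D e1]; exists C, D.
  by rewrite !frob_to_loc.
- move=> i Ji; have [h /nq hq] := dJ i Ji.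
  exact: contracts_loc.
- move=> k u jk; rewrite /B; apply: loc_exact => {}u ud.
  have [|s /nq sq us] := IHm k _ u ud; last by exists s.
  by apply: leq_trans Jj _; rewrite addnS -addSn leq_add2r.
- by rewrite -map_mxM -scalemxAl vd scaler0 map_mx0.
- move=> l; have /cP/q'P[w lw] := in_span_gen c l; exists (map_mx (to_loc q') w).
  by rewrite -map_mxM -lw [RHS]map_mxZ.
have [s [w' [sq ew]]] := to_loc_surj w.
have [t tq] : exists2 t, t \notin q' & t *: (s *: (a *: v)) = t *: (w' *m map_mx f (d j.+1)).
  apply: to_loc_mx_eq; rewrite map_mxM -ew map_mxZ vw.
  by rewrite scalemxAl.
move=> ets; have : t * s \in q'.
  apply/q'P; exists (t *: w'); rewrite -scalemxAl -ets !scalerA; congr (_ *: _).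
by rewrite (negPf (mul_notin tq sq)).
Qed.
End PeskineSzpiro.

(** * Linear maps into images, free modules *)

Section Image.
Variables (R : comNzRingType) (A B : lmodType R) (f : {linear A -> B}).

Definition in_image : {pred B} := fun y => `[< exists x, f x = y >].

Fact in_image_submod : submod_closed in_image.
Proof.
split; first by apply/asboolP; exists 0; rewrite linear0.
move=> a _ _ /asboolP[x <-] /asboolP[y <-]; apply/asboolP.
by exists (a *: x + y); rewrite linearP.
Qed.

HB.instance Definition _ := GRing.isSubmodClosed.Build R B in_image in_image_submod.

(** The image of f as a module of its own, to which the defining properties of
projective and injective modules apply. *)
Record image_mod := ImageMod { image_val : B; image_valP : image_val \in in_image }.
HB.instance Definition _ := [isSub for image_val].
HB.instance Definition _ := [Choice of image_mod by <:].
HB.instance Definition _ := [SubChoice_isSubLmodule of image_mod by <:].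

Fact image_incl_linear : linear image_val.
Proof. by move=> a x y; rewrite -[image_val]/(val) linearP. Qed.
HB.instance Definition _ := GRing.isLinear.Build R image_mod B *:%R image_val
  image_incl_linear.

Fact image_corP x : f x \in in_image.
Proof. by apply/asboolP; exists x. Qed.
Definition image_cor x := ImageMod (image_corP x).
Fact image_cor_linear : linear image_cor.
Proof. by move=> a x y; apply: val_inj; rewrite linearP /= linearP. Qed.
HB.instance Definition _ := GRing.isLinear.Build R A image_mod *:%R image_cor
  image_cor_linear.

Lemma image_cor_surj : surj image_cor.
Proof.
move=> [y yP]; have /asboolP[x e] := yP; exists x.
exact: val_inj.
Qed.

End Image.

Section Lifting.
Variable R : comNzRingType.

Lemma projective_lift (P A B : lmodType R) (h : {linear P -> B}) (g : {linear A -> B}) :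
  projective P -> (forall x, exists y, g y = h x) ->
  exists k : {linear P -> A}, forall x, g (k x) = h x.
Proof.
move=> projP hg.
have hP x : h x \in in_image g by have [y <-] := hg x; apply: image_corP.
pose h' x : image_mod g := ImageMod (hP x).
have h'_lin : linear h' by move=> a x y; apply: val_inj; rewrite linearP /= linearP.
pose h1 : {linear P -> image_mod g} := HB.pack h' (GRing.isLinear.Build R P _ _ h' h'_lin).
have [k kP] := projP _ _ (image_cor g : {linear A -> image_mod g}) h1 (@image_cor_surj _ _ _ g).
by exists k => x; have /(congr1 val) := kP x.
Qed.

(** The map h factors through the image of g, so injectivity of E is used for the
inclusion of that image. *)
Lemma injective_extend (E A B : lmodType R) (h : {linear A -> E}) (g : {linear A -> B}) :
  injective_module E -> (forall x, g x = 0 -> h x = 0) ->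
  exists k : {linear B -> E}, forall x, k (g x) = h x.
Proof.
move=> injE gh.
have heq x y : g x = g y -> h x = h y.
  move=> e; apply/eqP; rewrite -subr_eq0 -linearB; apply/eqP/gh.
  by rewrite linearB e subrr.
have /choice[s sP] : forall y : image_mod g, exists x, g x = val y.
  by move=> y; have /asboolP[x e] := image_valP y; exists x.
pose h' y := h (s y).
have h'_lin : linear h'.
  move=> a x y; rewrite /h' -linearP; apply: heq.
  by rewrite linearP !sP linearP.
pose h1 : {linear image_mod g -> E} := HB.pack h' (GRing.isLinear.Build R _ _ _ h' h'_lin).
have [k kP] := injE _ _ (@image_val _ _ _ g : {linear image_mod g -> B}) h1 val_inj.
exists k => x; have := kP (image_cor g x); rewrite /= => ->.
by apply: heq; rewrite sP.
Qed.

Section Rows.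
Variables (n : nat) (M : lmodType R) (y : 'I_n -> M).
Definition row_comb (v : 'rV[R]_n) : M := \sum_i v 0 i *: y i.
Fact row_comb_linear : linear row_comb.
Proof.
move=> a u v; rewrite /row_comb scaler_sumr -big_split; apply: eq_bigr => i _.
by rewrite !mxE scalerDl scalerA.
Qed.
HB.instance Definition _ := GRing.isLinear.Build R 'rV[R]_n M *:%R row_comb
  row_comb_linear.
Lemma row_comb_delta i : row_comb (delta_mx 0 i) = y i.
Proof.
rewrite /row_comb (bigD1 i) //= mxE !eqxx scale1r big1 ?addr0 // => j ji.
by rewrite mxE (negPf ji) andbF scale0r.
Qed.
End Rows.

Lemma linear_row_comb n (M : lmodType R) (f : {linear 'rV[R]_n -> M}) v :
  f v = row_comb (fun i => f (delta_mx 0 i)) v.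
Proof.
by rewrite {1}(row_sum_delta v) linear_sum; apply: eq_bigr => i _; rewrite linearZ.
Qed.

Lemma row_lift n (A B : lmodType R) (h : {linear 'rV[R]_n -> B}) (g : {linear A -> B}) :
  (forall x, exists y, g y = h x) ->
  exists k : {linear 'rV[R]_n -> A}, forall x, g (k x) = h x.
Proof.
move=> hg; have /choice[y yP] i : exists y, g y = h (delta_mx 0 i) by [].
exists (row_comb y) => x; rewrite (linear_row_comb h) linear_sum.
by apply: eq_bigr => i _; rewrite linearZ yP.
Qed.

Lemma row_projective n : projective 'rV[R]_n.
Proof. by move=> A B g h gs; apply: row_lift. Qed.

End Lifting.

(** * Free resolutions and their duals *)

Section FreeComplex.
Variable R : comNzRingType.

Definition rank_at (r : nat) (s : nat -> nat) j := if j is k.+1 then s k else r.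

(** The rank r in degree 0 is a parameter, so that a matrix into degree 0 can be
attached to the right without casting the dimensions. *)
Record free_complex (r : nat) := FreeComplex {
  tail_ranks : nat -> nat;
  diff : forall j, 'M[R]_(rank_at r tail_ranks j.+1, rank_at r tail_ranks j) }.

Definition ranks r (X : free_complex r) := rank_at r (tail_ranks X).

Definition cons_complex r m (e : 'M[R]_(r, m)) (X : free_complex r) : free_complex m :=
  FreeComplex (tail_ranks := ranks X)
      (fun j => match j return 'M_(rank_at m (ranks X) j.+1, rank_at m (ranks X) j) with
                | 0 => e | k.+1 => diff X k end).

Definition to_free_complex (n : nat -> nat) (d : forall j, 'M[R]_(n j.+1, n j)) :
    free_complex (n 0) :=
  FreeComplex (r := n 0) (tail_ranks := fun j => n j.+1)
      (fun j => match j return 'M_(rank_at (n 0) (fun j => n j.+1) j.+1,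
                                   rank_at (n 0) (fun j => n j.+1) j) with
                | 0 => d 0 | k.+1 => d k.+1 end).

Definition resolves r (X : free_complex r) :=
  is_complex (n := ranks X) (diff X) /\ acyclic (n := ranks X) (diff X).

(** Column vectors are the functionals on row vectors: this is exactness of the
dual complex at position j+1. *)
Definition dual_exact_at n (d : forall j, 'M[R]_(n j.+1, n j)) j :=
  forall w : 'cV_(n j.+1), d j.+1 *m w = 0 -> exists u, w = d j *m u.

Lemma resolves_cons r m (e : 'M[R]_(r, m)) (X : free_complex r) : resolves X ->
  diff X 0 *m e = 0 -> (forall v : 'rV_r, v *m e = 0 -> exists w, v = w *m diff X 0) ->
  resolves (cons_complex e X).
Proof. by move=> [XX exX] Xe exe; split=> -[|j] //=; [apply: XX|apply: exX]. Qed.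

Hypothesis noethR : noetherian R.

(** Generators for kernels are chosen repeatedly.  The state of the iteration is a
matrix with its two dimensions, and consecutive dimensions match by
computation. *)
Lemma resolution_ex a b (A : 'M[R]_(a, b)) :
  exists Z : free_complex a, resolves (cons_complex A Z).
Proof.
pose St := {ab : nat * nat & 'M[R]_(ab.1, ab.2)}.
have syzP (s : St) := noeth_ker noethR (projT2 s).
pose k s := projT1 (cid (syzP s)).
pose B s := projT1 (cid (projT2 (cid (syzP s)))).
have BP s := projT2 (cid (projT2 (cid (syzP s)))).
pose next (s : St) : St := existT (fun ab => 'M[R]_(ab.1, ab.2)) (k s, (projT1 s).1) (B s).
pose st j := iter j next (existT (fun ab => 'M[R]_(ab.1, ab.2)) (a, b) A).
pose Z : free_complex a := FreeComplex (r := a) (tail_ranks := fun j => (projT1 (st j.+1)).1)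
  (fun j => match j return 'M_(rank_at a (fun j => (projT1 (st j.+1)).1) j.+1,
     rank_at a (fun j => (projT1 (st j.+1)).1) j) with
     | 0 => B (st 0) | i.+1 => B (st i.+1) end).
exists Z; split=> [[|[|j]]|[|[|j]]] /=.
- exact: (BP (st 0)).1.
- exact: (BP (st 1)).1.
- exact: (BP (st j.+2)).1.
- exact: (BP (st 0)).2.
- exact: (BP (st 1)).2.
- exact: (BP (st j.+2)).2.
Qed.

End FreeComplex.

Section SelfInjective.
Variable R : comNzRingType.

(** Vanishing of Ext^j(-, R) for all j > c, in the form in which it is used: for
the module resolved by d, Ext^(j+1) is the homology of the dual complex at
position j+1. *)
Definition self_injdim_le c := forall n (d : forall j, 'M[R]_(n j.+1, n j)),
  is_complex d -> acyclic d -> forall j, (c <= j)%N -> dual_exact_at d j.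

Section Shift.
Variables (E : inj_resolution (R^o : lmodType R)) (l : nat).
Hypothesis El : forall i, (l < i)%N -> forall x : E i, x = 0.
Variables (n : nat -> nat) (d : forall j, 'M[R]_(n j.+1, n j)).
Hypotheses (dd : is_complex d) (exd : acyclic d).

(** Dimension shifting along the injective resolution.  A functional f that kills the
boundaries extends along the differential by injectivity of E_i; the defect of
this extension from being a cocycle of E lies in E_(i+1), at one position further
to the right, and can be corrected by induction until E_i = 0 is reached. *)
Lemma cosyzygy_ext m : forall i j (f : {linear 'rV[R]_(n j.+1) -> E i}),
  (l < i + m)%N -> (m <= j)%N -> (forall v, ires_d E i (f v) = 0) ->
  (forall v, f (v *m d j.+1) = 0) ->
  exists g : {linear 'rV[R]_(n j) -> E i},
    (forall v, ires_d E i (g v) = 0) /\ forall v, f v = g (v *m d j).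
Proof.
elim: m => [|m IHm] i j f li mj fZ fd.
  rewrite addn0 in li; exists (\0 : {linear 'rV[R]_(n j) -> E i}).
  by split=> v; rewrite /= ?linear0 //; apply: El.
case: j => // j in f mj fZ fd *.
have [|g0 g0P] := injective_extend (h := f) (g := mulmxr (d j.+1)) (@ires_injective _ _ E i).
  by move=> v /= /exd[w ->]; apply: fd.
have [||||g1 [g1Z g1P]] := IHm i.+1 j (ires_d E i \o g0).
- by rewrite addSnnS.
- by [].
- by move=> v /=; apply/ires_exactS; exists (g0 v).
- by move=> v /=; have /= -> := g0P v; apply: fZ.
have [|g2 g2P] := row_lift (h := g1) (g := ires_d E i).
  by move=> v; apply/ires_exactS.
exists (g0 \- (g2 \o mulmxr (d j))); split=> v /=.
  by rewrite linearB /= g2P -g1P /= subrr.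
have /= -> := g0P v.
by rewrite -mulmxA dd mulmx0 linear0 subr0.
Qed.

Lemma ext_vanish j : (l < j)%N -> dual_exact_at d j.
Proof.
move=> lj w dw.
pose f0 := ires_aug E \o row_comb (fun i => w i 0 : R^o).
have f0E v : f0 v = ires_aug E ((v *m w) 0 0).
  by rewrite /f0 /= /row_comb mxE.
have [||||g [gZ gP]] := cosyzygy_ext (m := l.+1) (i := 0) (f := f0).
- exact: leqnn.
- exact: lj.
- by move=> v; apply/ires_exact0; exists (row_comb (fun i => w i 0 : R^o) v).
- by move=> v; rewrite [LHS]f0E -mulmxA dw mulmx0 mxE linear0.
have [|k kP] := row_lift (h := g) (g := ires_aug E).
  by move=> v; apply/ires_exact0.
exists (\col_i k (delta_mx 0 i)); apply/colP=> i.
have : ((delta_mx 0 i : 'rV_(n j.+1)) *m w) 0 0 = k (delta_mx 0 i *m d j).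
  have aug_inj : injective (ires_aug E) by apply: ires_aug_inj.
  by apply: aug_inj; rewrite kP -gP [RHS]f0E.
rewrite -rowE mxE => ->.
rewrite (linear_row_comb k) /row_comb -rowE mxE; apply: eq_bigr => i' _.
by rewrite !mxE.
Qed.

End Shift.

Lemma gorenstein_self_injdim : gorenstein_local R -> exists c, self_injdim_le c.
Proof.
move=> [_ _ [E [l El]]]; exists l.+1 => n d dd exd j.
exact: (ext_vanish El dd exd).
Qed.

End SelfInjective.

(** * Cosyzygies over a Gorenstein ring *)

Section Cosyzygy.
Variable R : comNzRingType.
Hypothesis noethR : noetherian R.
Variable c : nat.
Hypothesis gorR : self_injdim_le R c.

Lemma trmx_exact m n p (A : 'M[R]_(m, n)) (B : 'M[R]_(n, p)) :
  (forall w : 'cV_n, A *m w = 0 -> exists u, w = B *m u) ->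
  forall v : 'rV_n, v *m A^T = 0 -> exists u, v = u *m B^T.
Proof.
move=> exAB v vA; have [|u e] := exAB v^T.
  by rewrite -[A]trmxK -trmx_mul vA trmx0.
by exists u^T; rewrite -trmx_mul -e trmxK.
Qed.

(** The columns of e generate the functionals that vanish on the image of the first
differential d_0 of X, so exactness of the extended dual holds by construction.
What has to be shown is that the cokernel of d_0 embeds in R^m through e.  Since the
dual of X is exact, for every k the transposes of e, d_0, ..., d_k form the end of a
resolution, of the cokernel of the transpose of d_k.  In this resolution
d_0 and e sit as far to the left as one likes, in the range where its own dual is
exact. *)
Lemma cosyzygy_step r (X : free_complex R r) : resolves X ->
  (forall j, dual_exact_at (n := ranks X) (diff X) j) ->
  exists m (e : 'M[R]_(r, m)), resolves (cons_complex e X) /\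
    forall j, dual_exact_at (n := ranks (cons_complex e X)) (diff (cons_complex e X)) j.
Proof.
move=> [XX exX] dualX.
have [m [B [Bd exB]]] := noeth_ker noethR (diff X 0)^T.
(* Rows generating the left kernel of the transpose are columns generating
the right kernel. *)
pose e := B^T.
have Xe : diff X 0 *m e = 0 by rewrite -[diff X 0]trmxK -trmx_mul Bd trmx0.
have exe (w : 'cV_r) : diff X 0 *m w = 0 -> exists u, w = e *m u.
  move=> Xw; have [|u eu] := exB w^T.
    by rewrite -trmx_mul Xw trmx0.
  by exists u^T; rewrite -[w]trmxK eu trmx_mul.
exists m, e; split; last by case.
apply: resolves_cons => // v ve.
suff Y k : exists Y : free_complex R (ranks X k.+1),
    [/\ resolves Y, diff Y 0 *m (diff X k.+1)^T = 0,
      forall u : 'rV_(ranks X k.+1), u *m (diff X k.+1)^T = 0 -> exists w, u = w *m diff Y 0 &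
      dual_exact_at (n := ranks Y) (diff Y) k -> exists w, v = w *m diff X 0].
  have [Y0 [resY _ _ dualY]] := Y c.
  exact/dualY/(gorR resY.1 resY.2 (leqnn c)).
elim: k => [|k [Y [resY Yd exY dualY]]]; last first.
  exists (cons_complex (diff X k.+1)^T Y); split=> //.
  - by apply: resolves_cons => // u uX; apply: exY.
  - by rewrite /= -trmx_mul XX trmx0.
  - exact: trmx_exact (dualX _).
have [Z [ZZ exZ]] := resolution_ex noethR e^T.
exists (cons_complex (diff X 0)^T (cons_complex e^T Z)); split=> //=.
- apply: resolves_cons => //=; first by rewrite -trmx_mul Xe trmx0.
  exact: (trmx_exact exe).
- by rewrite -trmx_mul XX trmx0.
- exact: (trmx_exact (dualX 0)).
move=> /(_ v^T)[|u eu]; first by rewrite /= -trmx_mul ve trmx0.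
exists u^T; apply: trmx_inj; rewrite trmx_mul trmxK; exact: eu.
Qed.

(** The first m terms of d are discarded and replaced by cosyzygies.  The comparison
map phi goes from the new complex to the old one: extending it one step to the
right is possible because the dual of the new complex is exact. *)
Lemma complete_step m : forall n (d : forall j, 'M[R]_(n j.+1, n j)),
  is_complex d -> acyclic d -> (forall j, (m <= j)%N -> dual_exact_at d j) ->
  exists r (X : free_complex R r) (phi : forall j, 'M[R]_(ranks X j, n j)),
    [/\ resolves X, forall j, dual_exact_at (n := ranks X) (diff X) j,
       forall j, diff X j *m phi j = phi j.+1 *m d j &
       forall j, (m <= j)%N -> exists psi, phi j *m psi = 1%:M /\ psi *m phi j = 1%:M].
Proof.
elim: m => [|m IHm] n d dd exd dual.
  exists (n 0), (to_free_complex d).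
  exists (fun j => match j return 'M[R]_(ranks (to_free_complex d) j, n j) with
     | 0 => 1%:M | k.+1 => 1%:M end).
  split.
  - split; first by case=> [|j]; apply: dd.
    by case=> [|j]; apply: exd.
  - by case=> [|j]; apply: dual.
  - by case=> [|j] /=; rewrite mulmx1 mul1mx.
  - by case=> [|j] _; exists 1%:M; rewrite mulmx1.
have [||j mj|r [X [phi [resX dualX Xphi phiV]]]] :=
  IHm (fun j => n j.+1) (fun j => d j.+1).
- by move=> j; apply: dd.
- by move=> j; apply: exd.
- exact: dual.
have [k [e [resC dualC]]] := cosyzygy_step resX dualX.
have [phi0 phi0P] : exists phi0, e *m phi0 = phi 0 *m d 0.
  have /choice[u uP] i : exists u, col i (phi 0 *m d 0) = e *m u.
    apply: (dualC 0); rewrite /= colE !mulmxA Xphi -(mulmxA (phi 1)) dd.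
    by rewrite mulmx0 mul0mx.
  exists (\matrix_(i, j) u j i 0); apply/matrixP=> i j.
  have /matrixP/(_ i 0) := uP j; rewrite !mxE => ->.
  by apply: eq_bigr => l _; rewrite !mxE.
exists k, (cons_complex e X).
exists (fun j => match j return 'M[R]_(ranks (cons_complex e X) j, n j) with
   | 0 => phi0 | i.+1 => phi i end).
split=> // -[|j] //; [exact: Xphi | exact: phiV].
Qed.

(** X is the complex obtained from d by replacing its first c terms.  D extends it by
one cosyzygy, and h is the comparison map from X to d, seen as a map of degree -1
on D.  The further matrix e realizes the module resolved by D as a submodule of a
free module. *)
Lemma gorenstein_hull n (d : forall j, 'M[R]_(n j.+1, n j)) :
  is_complex d -> acyclic d ->
  exists r (D : free_complex R r) k (e : 'M[R]_(r, k))
      (h : forall j, 'M[R]_(ranks D j.+1, n j)),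
    [/\ resolves (cons_complex e D),
       forall j, diff D j.+1 *m h j = h j.+1 *m d j &
       forall j, (c <= j)%N -> exists k, h j *m k = 1%:M /\ k *m h j = 1%:M].
Proof.
move=> dd exd.
have [|r [X [phi [resX dualX Xphi phiV]]]] := complete_step (m := c) dd exd.
  exact: gorR.
have [k [e [resC dualC]]] := cosyzygy_step resX dualX.
have [k' [e' [resC' _]]] := cosyzygy_step resC dualC.
by exists k, (cons_complex e X), k', e', phi.
Qed.

End Cosyzygy.

(** * The mapping cone *)

Section Cone.
Variables (R : comNzRingType) (l x : nat -> nat).
Variables (L : forall j, 'M[R]_(l j.+1, l j)) (D : forall j, 'M[R]_(x j.+1, x j)).
Variable h : forall j, 'M[R]_(x j.+1, l j).
Hypothesis Dh : forall j, D j.+1 *m h j = h j.+1 *m L j.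

(** The cone of the chain map h of degree -1; it resolves the module Q of the
exact sequence 0 -> M -> Q -> X -> 0, where L resolves M and D resolves X. *)
Definition cone j : 'M[R]_(l j.+1 + x j.+1, l j + x j) :=
  block_mx (L j) 0 (h j) (- D j).

Lemma cone_mul j (u : 'rV_(l j.+1)) (v : 'rV_(x j.+1)) :
  row_mx u v *m cone j = row_mx (u *m L j + v *m h j) (- (v *m D j)).
Proof. by rewrite mul_row_block mulmx0 add0r mulmxN. Qed.

Hypotheses (LL : is_complex L) (DD : is_complex D).

Lemma cone_complex : is_complex (n := fun j => l j + x j)%N cone.
Proof.
move=> j; rewrite /cone mulmx_block LL !mulNmx !mulmxN !mul0mx !mulmx0 DD Dh.
by rewrite !oppr0 subrr !addr0 block_mx0.
Qed.

Lemma cone_acyclic : acyclic L -> acyclic D ->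
  acyclic (n := fun j => l j + x j)%N cone.
Proof.
move=> exL exD j v; rewrite -[v]hsubmxK; move: (lsubmx v) (rsubmx v) => {v} u v.
rewrite cone_mul -row_mx0 => /eq_row_mx[uv /eqP].
rewrite oppr_eq0 => /eqP/exD[w vw].
have [|y uy] := exL j (u + w *m h j.+1).
  by rewrite mulmxDl -mulmxA -Dh mulmxA -vw.
exists (row_mx y (- w)); rewrite cone_mul !mulNmx opprK -vw -uy addrK.
by [].
Qed.

Lemma inverse_commutes j k k' : k *m h j.+1 = 1%:M -> h j *m k' = 1%:M ->
  k *m D j.+1 = L j *m k'.
Proof.
move=> kh hk'.
by rewrite -[RHS]mul1mx -kh -!mulmxA (mulmxA (h _)) -Dh -!mulmxA hk' mulmx1.
Qed.

(** Where h is invertible, its inverse is a contraction of the cone. *)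
Lemma cone_contracts j k k' : k *m h j.+1 = 1%:M -> h j *m k' = 1%:M ->
  contracts 1 (n := fun j => l j + x j)%N cone j.
Proof.
move=> kh hk'.
exists (block_mx 0 k 0 0 : 'M_(l j.+1 + x j.+1, l j.+2 + x j.+2)).
exists (block_mx 0 k' 0 0 : 'M_(l j + x j, l j.+1 + x j.+1)).
rewrite /cone !mulmx_block !mul0mx !mulmx0 !addr0 !add0r mulmxN.
rewrite (inverse_commutes kh hk') add_block_mx !addr0 !add0r kh hk' addNr.
by rewrite -scalar_mx_block.
Qed.

End Cone.

(** * Finite projective dimension and contractions *)

(** A splitting passes to retracts.  Only the part of the comparison maps around
position j+1 matters. *)
Lemma contracts_retract (R : comNzRingType) a j
    n (d : forall j, 'M[R]_(n j.+1, n j)) n' (d' : forall j, 'M[R]_(n' j.+1, n' j))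
    (f0 : 'M_(n j, n' j)) (f1 : 'M_(n j.+1, n' j.+1)) (g1 : 'M_(n' j.+1, n j.+1))
    (g2 : 'M_(n' j.+2, n j.+2)) :
  d j *m f0 = f1 *m d' j -> d' j.+1 *m g1 = g2 *m d j.+1 -> f1 *m g1 = 1%:M ->
  contracts a d' j -> contracts a d j.
Proof.
move=> f01 g12 fg [C [D e]]; exists (f1 *m C *m g2), (f0 *m D *m g1).
rewrite -(mulmxA _ g2) -g12 !mulmxA f01 -!mulmxA -mulmxDr !mulmxA -mulmxDl -e.
by rewrite mul_scalar_mx -scalemxAr fg scalemx1.
Qed.

(** Chain maps and homotopies are built degree by degree from it. *)
Lemma dependent_choice (T : nat -> Type) (Q : forall i, T i -> T i.+1 -> Prop) (x0 : T 0) :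
  (forall i x, exists y, Q i x y) ->
  exists f : forall i, T i, f 0 = x0 /\ forall i, Q i (f i) (f i.+1).
Proof.
move=> ex; have step i x := cid (ex i x).
pose f := fix f i : T i := match i with 0 => x0 | k.+1 => projT1 (step k (f k)) end.
by exists f; split=> // i; apply: projT2 (step i (f i)).
Qed.

Section Comparison.
Variables (R : comNzRingType) (X Y : nat -> lmodType R).
Variables (dX : forall i, {linear X i.+1 -> X i}) (dY : forall i, {linear Y i.+1 -> Y i}).
Hypothesis projX : forall i, projective (X i).
Hypothesis dXX : forall i x, dX i (dX i.+1 x) = 0.
Hypothesis exY : forall i y, dY i y = 0 -> exists z, dY i.+1 z = y.

Lemma lift_chain (a0 : {linear X 0 -> Y 0}) :
  (forall x, exists y, dY 0 y = a0 (dX 0 x)) ->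
  exists a : forall i, {linear X i -> Y i}, a 0 = a0 /\
    forall i x, dY i (a i.+1 x) = a i (dX i x).
Proof.
move=> a0P.
pose good i (a : {linear X i -> Y i}) := forall x, exists y, dY i y = a (dX i x).
pose T i := {a : {linear X i -> Y i} | good i a}.
pose Q i (a : T i) (b : T i.+1) := forall x, dY i (sval b x) = sval a (dX i x).
have [|f [f0 fP]] := @dependent_choice T Q (exist _ a0 a0P).
  move=> i [a aP]; have [b bP] :=
    projective_lift (h := a \o dX i) (g := dY i) (@projX i.+1) aP.
  have bG : good i.+1 b.
    by move=> x; apply: exY; rewrite bP /= dXX linear0.
  by exists (exist _ b bG) => x; apply: bP.
by exists (fun i => sval (f i)); rewrite f0.
Qed.

Lemma lift_homotopy (c : forall i, {linear X i -> Y i}) :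
  (forall i x, dY i (c i.+1 x) = c i (dX i x)) ->
  (forall x, exists y, dY 0 y = c 0 x) ->
  exists h : forall i, {linear X i -> Y i.+1},
    forall i x, c i.+1 x = dY i.+1 (h i.+1 x) + h i (dX i x).
Proof.
move=> cd c0.
pose good i (h : {linear X i -> Y i.+1}) := forall x, dY i (h (dX i x)) = c i (dX i x).
pose T i := {h : {linear X i -> Y i.+1} | good i h}.
pose Q i (h : T i) (h' : T i.+1) :=
  forall x, c i.+1 x = dY i.+1 (sval h' x) + sval h (dX i x).
have [h0 h0P] := projective_lift (@projX 0) c0.
have h0G : good 0 h0 by move=> x; rewrite h0P.
have [|f [_ fP]] := @dependent_choice T Q (exist _ h0 h0G); last first.
  by exists (fun i => sval (f i)).
move=> i [h hG].
have [|h' hP] := projective_lift (h := c i.+1 \- (h \o dX i)) (g := dY i.+1) (@projX i.+1).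
  by move=> x; apply: exY; rewrite /= linearB cd hG subrr.
have h'G : good i.+1 h'.
  by move=> x; rewrite hP /= dXX linear0 subr0.
by exists (exist _ h' h'G) => x /=; rewrite hP /= subrK.
Qed.

End Comparison.

Section Presentation.
Variable R : comNzRingType.

Definition presents m n (A : 'M[R]_(m, n)) (M : lmodType R) (g : 'I_n -> M) :=
  (forall x, exists v, x = row_comb g v) /\
  forall v, row_comb g v = 0 <-> exists w, v = w *m A.

Variables (n : nat -> nat) (d : forall j, 'M[R]_(n j.+1, n j)).
Hypotheses (dd : is_complex d) (exd : acyclic d).
Variables (M : lmodType R) (g : 'I_(n 0) -> M).
Hypothesis Mg : presents (d 0) g.

(** Compare the free resolution with a projective resolution P of length l, in both
directions.  The composite is homotopic to the identity of the free one, and it is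
zero beyond degree l because P is; the homotopy is then a splitting. *)
Lemma presentation_projdim : finite_projdim M ->
  exists J, forall j, (J <= j)%N -> contracts 1 d j.
Proof.
move=> [P [l Pl]]; exists l => j lj.
have PP i x : pres_d P i (pres_d P i.+1 x) = 0.
  by apply/(@pres_exactS _ _ P i _); exists x.
have exP i y : pres_d P i y = 0 -> exists z, pres_d P i.+1 z = y.
  by move/(@pres_exactS _ _ P i _).
pose L i : lmodType R := 'rV[R]_(n i).
pose dL i : {linear L i.+1 -> L i} := mulmxr (d i).
have LL i x : dL i (dL i.+1 x) = 0 by rewrite /= -mulmxA dd mulmx0.
have exL i y : dL i y = 0 -> exists z, dL i.+1 z = y.
  by move=> /exd[w ->]; exists w.
have [gsurj gker] := Mg.
have [a0 a0P] := row_lift (h := row_comb g) (g := pres_aug P)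
  (fun x => @pres_aug_surj _ _ P _).
have [|a [a0E aP]] := lift_chain (fun i => @row_projective R (n i)) LL exP (a0 := a0).
  move=> x; apply/(@pres_exact0 _ _ P _); rewrite a0P; apply/gker.
  by exists x.
have [|b0 b0P] := projective_lift (h := pres_aug P) (g := row_comb g) (@pres_projective _ _ P 0).
  by move=> x; have [v e] := gsurj (pres_aug P x); exists v.
have [|b [b0E bP]] := lift_chain (@pres_projective _ _ P) PP exL (a0 := b0).
  move=> x; have /gker[w e] : row_comb g (b0 (pres_d P 0 x)) = 0.
    by rewrite b0P; apply/(@pres_exact0 _ _ P _); exists x.
  by exists w.
pose c i : {linear L i -> L i} := idfun \- (b i \o a i).
have [||h hP] := lift_homotopy (fun i => @row_projective R (n i)) LL exL (c := c).
- move=> i x; rewrite /c /= mulmxBl; congr (_ - _).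
  by apply: etrans (bP i _) _; rewrite aP.
- move=> x; have /gker[w e] : row_comb g (c 0 x) = 0.
    by rewrite -[c 0 x]/(x - b 0 (a 0 x)) linearB b0E a0E b0P a0P subrr.
  by exists w.
exists (lin1_mx (h j.+1)), (lin1_mx (h j)); apply/row_matrixP => i.
rewrite !rowE mulmxDr !mulmxA mul_rV_lin1 mul_rV_lin1 mulmx1.
have a_j x : a j.+1 x = 0 by apply: Pl.
by have := hP j (delta_mx 0 i); rewrite /c /= a_j linear0 subr0.
Qed.

Definition free_resolution : proj_resolution M.
Proof.
refine (@ProjResolution R M (fun i => 'rV[R]_(n i) : lmodType R)
  (fun i => mulmxr (d i)) (row_comb g) (fun i => @row_projective R (n i)) _ _ _).
- by move=> x; have [v ->] := Mg.1 x; exists v.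
- move=> v; split=> [/Mg.2[w ->]|[w <-]]; first by exists w.
  by apply/Mg.2; exists w.
- move=> i v; split=> [/exd[w ->]|[w <-]]; first by exists w.
  by rewrite /= -mulmxA dd mulmx0.
Defined.

End Presentation.

Lemma fin_gen_resolution (R : comNzRingType) (M : lmodType R) :
  noetherian R -> fin_gen M ->
  exists k (L : free_complex R k) (g : 'I_k -> M), resolves L /\ presents (diff L 0) g.
Proof.
move=> noethR [k [g gP]].
have [|a [A AP]] := @noeth_mx R noethR k (fun v => row_comb g v = 0).
  split; first exact: linear0.
  by move=> b x y x0 y0; rewrite linearP /= x0 y0 scaler0 addr0.
have [Z resZ] := resolution_ex noethR A.
exists k, (cons_complex A Z), g; split=> //; split=> //.
move=> x; have [c ->] := gP x; exists (\row_i c i).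
by apply: eq_bigr => i _; rewrite mxE.
Qed.

Section FiniteProjdim.
Variable R : comNzRingType.

(** The resolution is P in degree 0 and the free module of rank 0 in the other
degrees. *)
Lemma projdim_projective (P : lmodType R) : projective P -> finite_projdim P.
Proof.
move=> projP.
pose obj i : lmodType R := if i is _.+1 then 'rV[R]_0 else P.
have z0 (v : 'rV[R]_0) : v = 0 by apply/rowP=> -[].
pose dP i : {linear obj i.+1 -> obj i} := \0.
unshelve eexists; last exists 0.
  refine (@ProjResolution R P obj dP idfun _ _ _ _).
  - by case=> [|i] //; apply: row_projective.
  - by move=> x; exists x.
  - by move=> x; split=> [e|[y <-]]; first by exists 0; symmetry; exact: e.
  - by move=> i x; split=> [_|//]; exists 0; rewrite (z0 x).
by case=> // i _ x; apply: z0.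
Qed.

Lemma projdim_extension (K P M : lmodType R) (i : {linear K -> P}) (g : {linear P -> M}) :
  projective P -> injective i -> surj g -> exact_at i g ->
  finite_projdim K -> finite_projdim M.
Proof.
move=> projP inj_i surj_g ex_ig [Q [l Ql]].
pose obj k : lmodType R := if k is k'.+1 then Q k' else P.
pose dP k : {linear obj k.+1 -> obj k} :=
  match k return {linear obj k.+1 -> obj k} with
  | 0 => i \o pres_aug Q | k'.+1 => pres_d Q k' end.
have i0 x : i x = 0 -> x = 0 by rewrite -(linear0 i) => /inj_i.
unshelve eexists; last exists l.+1.
  refine (@ProjResolution R M obj dP g _ surj_g _ _).
  - by case=> [|k] //; apply: pres_projective.
  - move=> y; split=> [/ex_ig[x <-]|[x <-]].
      by have [z <-] := @pres_aug_surj _ _ Q x; exists z.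
    by apply/ex_ig; exists (pres_aug Q x).
  - case=> [|k] y /=; last exact: pres_exactS.
    by split=> [/i0/pres_exact0//|/pres_exact0 ->]; rewrite linear0.
by case=> // k lk x; apply: Ql.
Qed.

Lemma projective_retract (P Q : lmodType R) (s : {linear P -> Q}) (r : {linear Q -> P}) :
  (forall x, r (s x) = x) -> projective Q -> projective P.
Proof.
move=> rs projQ A B g h surj_g.
have [k kP] := projQ _ _ g (h \o r) surj_g.
by exists (k \o s) => x; rewrite /= kP /= rs.
Qed.

Variables (n : nat -> nat) (d : forall j, 'M[R]_(n j.+1, n j)).
Hypotheses (dd : is_complex d) (exd : acyclic d).

Let Om j : lmodType R := image_mod (mulmxr (d j) : {linear 'rV[R]_(n j.+1) -> 'rV[R]_(n j)}).

Lemma contracts_projective j : contracts 1 d j -> projective (Om j).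
Proof.
move=> [C [D e1]].
pose s : {linear Om j -> 'rV[R]_(n j.+1)} := mulmxr D \o @image_val _ _ _ _.
pose r : {linear 'rV[R]_(n j.+1) -> Om j} := @image_cor _ _ _ _.
apply: (projective_retract (s := s) (r := r)); last exact: row_projective.
move=> x; have [v <-] := image_cor_surj x; apply: val_inj => /=.
have dDd : d j *m D *m d j = d j.
  by rewrite -[RHS]mul1mx e1 mulmxDl -[C *m _ *m _]mulmxA dd mulmx0 add0r.
by rewrite -!mulmxA (mulmxA _ D) dDd.
Qed.

(** [Om (j + k)] is projective, and each [Om j] is the quotient of a free module by
the next one. *)
Lemma syzygy_projdim j k : contracts 1 d (j + k) -> finite_projdim (Om j).
Proof.
elim: k j => [|k IHk] j ctr.
  by apply/projdim_projective/contracts_projective; rewrite -[j]addn0.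
have fK := IHk j.+1; rewrite addSnnS in fK.
apply: (projdim_extension (i := @image_val _ _ _ _) (g := @image_cor _ _ _ _) _ _ _ _ (fK ctr)).
- exact: row_projective.
- exact: val_inj.
- exact: image_cor_surj.
- move=> v; split=> [/(congr1 val)/= vd|[x <-]].
    have [w ->] := exd vd.
    by exists (image_cor (mulmxr (d j.+1)) w).
  have [w <-] := image_cor_surj x; apply: val_inj => /=.
  by rewrite -mulmxA dd mulmx0.
Qed.

Lemma contracts_projdim (M : lmodType R) (g : 'I_(n 0) -> M) j :
  presents (d 0) g -> contracts 1 d j -> finite_projdim M.
Proof.
move=> [gsurj gker] ctr.
have fK := @syzygy_projdim 0 j ctr.
apply: (projdim_extension (i := @image_val _ _ _ _) (g := row_comb g) _ _ _ _ fK).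
- exact: row_projective.
- exact: val_inj.
- by move=> x; have [v ->] := gsurj x; exists v.
- move=> v; split=> [/gker[w ->]|[x <-]].
    by exists (image_cor (mulmxr (d 0)) w).
  by have [w <-] := image_cor_surj x; apply/gker; exists w.
Qed.

End FiniteProjdim.

(** * Tensor products with free modules and the Frobenius functor *)

Section PureTensor.
Variables (R : comNzRingType) (M N : lmodType R).

Lemma pure0r (x : M) : pure_tensor x (0 : N) = 0.
Proof. by rewrite -(scale0r (0 : N)) -pureZ scale0r pure0l. Qed.

Lemma pure_suml (I : finType) (F : I -> M) (y : N) :
  pure_tensor (\sum_i F i) y = \sum_i pure_tensor (F i) y.
Proof. by apply: (big_morph (fun x => pure_tensor x y)) => [? ?|]; rewrite (pureDl, pure0l). Qed.

Lemma pure_sumr (I : finType) (x : M) (F : I -> N) :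
  pure_tensor x (\sum_i F i) = \sum_i pure_tensor x (F i).
Proof. by apply: (big_morph (pure_tensor x)) => [? ?|]; rewrite (pureDr, pure0r). Qed.

End PureTensor.

Section TensorRow.
Variables (R : comNzRingType) (N : lmodType R).

(** The isomorphism from N^n to the tensor product of R^n and N. *)
Definition row_tensor n (y : 'I_n -> N) : tensor 'rV[R]_n N :=
  \sum_i pure_tensor (delta_mx 0 i) (y i).

Lemma row_tensor_surj n (t : tensor 'rV[R]_n N) : exists y, t = row_tensor y.
Proof.
elim/tensor_ind: t => [|x y t [z ->]].
  by exists (fun=> 0); rewrite /row_tensor big1 // => i _; rewrite pure0r.
exists (fun i => x 0 i *: y + z i); rewrite {1}(row_sum_delta x) pure_suml.
rewrite -big_split; apply: eq_bigr => i _.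
by rewrite pureDr pureZ.
Qed.

Definition row_coord n (i : 'I_n) : tensor 'rV[R]_n N -> N :=
  tlift (fun (x : 'rV[R]_n) (y : N) => x 0 i *: y).

Lemma row_coord_tensor n (i : 'I_n) y : row_coord i (row_tensor y) = y i.
Proof.
have h0 (z : N) : (0 : 'rV[R]_n) 0 i *: z = 0 by rewrite mxE scale0r.
have hDl (x x' : 'rV[R]_n) (z : N) : (x + x') 0 i *: z = x 0 i *: z + x' 0 i *: z.
  by rewrite mxE scalerDl.
have hDr (x : 'rV[R]_n) (z z' : N) : x 0 i *: (z + z') = x 0 i *: z + x 0 i *: z'.
  by rewrite scalerDr.
have hZ a (x : 'rV[R]_n) (z : N) : (a *: x) 0 i *: z = x 0 i *: (a *: z).
  by rewrite mxE scalerA mulrC.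
rewrite /row_coord /row_tensor (big_morph _ (tliftD h0 hDl hDr hZ) (tlift0 h0 hDl hDr hZ)).
rewrite (bigD1 i) //= tlift_pure // mxE !eqxx scale1r big1 ?addr0 // => j ji.
by rewrite tlift_pure // mxE eq_sym (negPf ji) andbF scale0r.
Qed.

Lemma row_tensor0 n (y : 'I_n -> N) : row_tensor y = 0 -> forall i, y i = 0.
Proof.
move=> y0 i; rewrite -[LHS](row_coord_tensor i) y0.
rewrite -[RHS](row_coord_tensor i (fun=> 0)); congr (row_coord i _).
by rewrite /row_tensor big1 // => j _; rewrite pure0r.
Qed.

Lemma tensor_map_row m n (A : 'M[R]_(m, n)) y :
  tensor_map (mulmxr A : {linear 'rV_m -> 'rV_n}) (idfun : {linear N -> N}) (row_tensor y) =
  row_tensor (act A y).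
Proof.
transitivity (\sum_i \sum_j pure_tensor (delta_mx 0 j : 'rV[R]_n) (A i j *: y i)).
  rewrite /row_tensor linear_sum; apply: eq_bigr => i _.
  rewrite [LHS]tensor_map_pure /= -rowE [row _ _]row_sum_delta pure_suml.
  by apply: eq_bigr => j _; rewrite pureZ mxE.
by rewrite exchange_big; apply: eq_bigr => j _; rewrite pure_sumr.
Qed.

Lemma row_tensor_eq n (y z : 'I_n -> N) :
  (forall i, y i = z i) -> row_tensor y = row_tensor z.
Proof. by move=> yz; apply: eq_bigr => i _; rewrite yz. Qed.

(** Tensoring the free resolution with N gives the action of its matrices on rows of
elements of N. *)
Lemma tor1_zero n (d : forall j, 'M[R]_(n j.+1, n j)) (M : lmodType R) (g : 'I_(n 0) -> M) :
  is_complex d -> acyclic d -> presents (d 0) g ->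
  acyclic_mod d (fun x : N => x = 0) 0 -> Tor_zero 1 M N.
Proof.
move=> dd exd Mg exN; exists (free_resolution dd exd Mg) => t.
have torE i y : tor_d N (free_resolution dd exd Mg) i (row_tensor y) =
    row_tensor (act (d i) y) by apply: tensor_map_row.
split=> [|[u <-]].
  have [y ->] := row_tensor_surj t; rewrite torE => y0.
  have [|w wy] := exN y.
    by move=> k; apply: row_tensor0 y0 k.
  exists (row_tensor w); rewrite torE.
  by apply: row_tensor_eq => i; apply/eqP; rewrite eq_sym -subr_eq0; apply/eqP.
have [w ->] := row_tensor_surj u; rewrite !torE.
rewrite /row_tensor big1 // => i _.
by rewrite -act_mul dd act0 pure0r.
Qed.

End TensorRow.

Section FrobeniusFunctor.
Variables (R : comNzRingType) (p : nat) (pcharR : p \in [pchar R]) (e : nat).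
Local Notation f := (frob_iter e pcharR).
Local Notation N := (frob_module pcharR e).

(** A common denominator s reduces a cycle over the localization to one over R.  A
scalar b acts on the Frobenius module through its power, so that matrices act by
their twists. *)
Lemma loc_frob_acyclic (q : prime_idealr R) n (d : forall j, 'M[R]_(n j.+1, n j)) j :
  (forall v : 'rV_(n j.+1), v *m map_mx f (d j) = 0 ->
     exists w, v = w *m map_mx f (d j.+1)) ->
  acyclic_mod (fun j => map_mx (to_loc q) (d j)) (fun x : loc_mod q N => x = 0) j.
Proof.
move=> exf y y0; have [s [x yx]] := common_denom y.
have actE m k (A : 'M[R]_(m, k)) (z : 'I_m -> N) t l :
    act (map_mx (to_loc q) A) (fun i => frac (z i) t : loc_mod q N) l =
    frac (act A z l) t.
  have fracD u v : frac (u + v : N) t = frac u t + frac v t.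
    by rewrite add_frac_same.
  rewrite /act (big_morph (fun u => frac u t) fracD (frac0 _ _)).
  by apply: eq_bigr => i _; rewrite mxE to_loc_scale.
have actN m k (A : 'M[R]_(m, k)) (z : 'rV[R]_m) l :
    act A (fun i => z 0 i : N) l = (z *m map_mx f A) 0 l.
  rewrite mxE; apply: eq_bigr => i _.
  by rewrite frob_module_scale mxE mulrC.
have yE : y = fun i => frac (x i) s by apply: funext.
rewrite {}yE in y0 *.
have /choice[w wP] l : exists w, w \notin q /\ w *: act (d j) x l = 0.
  have := y0 l; rewrite actE -(frac0 _ s) => /fracP[w].
  rewrite scaler0 => ws; exists (val w * val s); split=> //.
  by apply: mul_notin; [exact: (valP w) | exact: (valP s)].
pose b := \prod_l w l.
have bq : b \notin q by apply: prod_notin => l; case: (wP l).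
have bx l : act (d j) (fun i => b *: x i) l = 0.
  by rewrite actZ /b (bigD1 l) //= mulrC -scalerA (wP l).2 scaler0.
have rowE' (z : 'I_(n j.+1) -> N) : (fun i => (\row_k (z k : R)) 0 i : N) = z.
  by apply: funext => i; rewrite mxE.
have [|u bxu] := exf (\row_k (b *: x k : N)).
  by apply/rowP=> l; rewrite -actN rowE' bx mxE.
exists (fun i => frac (u 0 i : N) (denomM (mk_denom bq) s)) => k.
rewrite actE actN -bxu mxE.
apply/eqP; rewrite subr_eq0; apply/eqP/frac_eq.
by rewrite val_denomM scalerA mulrC.
Qed.

(** The surjection from R^k onto F^n(M) given by generators g of M. *)
Definition frob_gen k (M : lmodType R) (g : 'I_k -> M) (v : 'rV[R]_k) :
    frob_functor pcharR e M :=
  \sum_i pure_tensor (g i) (v 0 i : N).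

Lemma frob_gen_scale k (M : lmodType R) (g : 'I_k -> M) v a :
  a *: frob_gen g v = frob_gen g (a *: v).
Proof.
rewrite scaler_sumr; apply: eq_bigr => i _.
by rewrite [LHS]frob_functor_scale mxE.
Qed.

(** Right exactness of the tensor product: twisted relations of M present F^n(M).
For a vanishing sum of tensors to come from relations, each element of M is
replaced by an arbitrary combination of the generators representing it; modulo the
twisted relations this choice is immaterial, and the result respects each of the
rules that generate equality in the tensor product. *)
Lemma frob_gen_eq0 m k (A : 'M[R]_(m, k)) (M : lmodType R) (g : 'I_k -> M) v :
  presents A g -> frob_gen g v = 0 <-> exists w, v = w *m map_mx f A.
Proof.
move=> [gsurj gker]; split; last first.
  move=> [w ->].
  transitivity (\sum_i \sum_j pure_tensor (A j i *: g i) (w 0 j : N)).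
    apply: eq_bigr => i _; rewrite mxE.
    rewrite [LHS](pure_sumr (g i) (fun j => (w 0 j * map_mx f A j i : R) : N)).
    apply: eq_bigr => j _; rewrite pureZ frob_module_scale mxE.
    by rewrite mulrC.
  rewrite exchange_big big1 // => j _.
  have rj : row_comb g (row j A) = 0.
    by apply/gker; exists (delta_mx 0 j); rewrite -rowE.
  rewrite -pure_suml (_ : \sum_i _ = 0) ?pure0l // -[RHS]rj.
  by apply: eq_bigr => i _; rewrite mxE.
have /choice[sec secP] x : exists u, row_comb g u = x.
  by have [u ->] := gsurj x; exists u.
(* The inverse map, defined on formal sums of pairs. *)
pose Phi (s : seq (M * N)) : 'rV[R]_k := \sum_(z <- s) (z.2 : R) *: map_mx f (sec z.1).
pose im (u : 'rV[R]_k) := exists w, u = w *m map_mx f A.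
have im0 : im 0 by exists 0; rewrite mul0mx.
have imD u u' : im u -> im u' -> im (u + u').
  by move=> [w ->] [w' ->]; exists (w + w'); rewrite mulmxDl.
have imZ a u : im u -> im (a *: u).
  by move=> [w ->]; exists (a *: w); rewrite scalemxAl.
have imN u : im u -> im (- u) by rewrite -scaleN1r; apply: imZ.
have imf u : row_comb g u = 0 -> im (map_mx f u).
  by move=> /gker[w ->]; exists (map_mx f w); rewrite map_mxM.
have Phi_rel s t : tensor_rel s t -> im (Phi s - Phi t).
  elim=> {s t} [s|s t _ st|s t u _ st _ tu|s s' t t' _ ss _ tt|s t|y|x x' y|x y y'|a x y].
  - by rewrite subrr.
  - by rewrite -opprB; apply: imN.
  - by have := imD _ _ st tu; rewrite addrA subrK.
  - by rewrite /Phi !big_cat /= opprD addrACA; apply: imD.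
  - by rewrite /Phi !big_cat /= addrC subrr.
  - rewrite /Phi big_cons !big_nil addr0 subr0; apply: imZ; apply: imf.
    exact: secP.
  - rewrite /Phi !big_cons !big_nil !addr0 /= -scalerDr -scalerBr -map_mxD -map_mxB.
    by apply: imZ; apply: imf; rewrite linearB linearD /= !secP subrr.
  - by rewrite /Phi !big_cons !big_nil !addr0 /= -scalerDl subrr.
  - rewrite /Phi !big_cons !big_nil !addr0 /= frob_module_scale mulrC -scalerA.
    have -> : a ^+ (p ^ e) *: map_mx f (sec x) = map_mx f (a *: sec x).
      by rewrite map_mxZ.
    rewrite -scalerBr -map_mxB; apply: imZ; apply: imf.
    by rewrite linearB linearZ /= !secP subrr.
move=> v0.
pose s : seq (M * N) := [seq (g i, v 0 i : N) | i <- index_enum 'I_k].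
have sE : tpi s = frob_gen g v.
  rewrite /frob_gen /s; elim: (index_enum _) => [|i r IHr]; first by rewrite big_nil.
  by rewrite big_cons /= tpi_cons IHr.
have /Phi_rel : tensor_rel s [::] by apply/tpiP; rewrite sE.
rewrite /Phi big_nil subr0 big_map => imPhi.
suff imv : im (\sum_i v 0 i *: map_mx f (sec (g i)) - v).
  by have := imD _ _ imPhi (imN _ imv); rewrite /= opprB addrC subrK.
rewrite [X in _ - X]row_sum_delta -sumrB.
apply: (big_ind im) => // i _; rewrite -scalerBr; apply: imZ.
have -> : delta_mx 0 i = map_mx f (delta_mx 0 i) :> 'rV_k by rewrite map_delta_mx.
rewrite -map_mxB; apply: imf.
by rewrite linearB /= secP row_comb_delta subrr.
Qed.

End FrobeniusFunctor.

Lemma loc_presents (R : comNzRingType) (q : prime_idealr R) m n (A : 'M[R]_(m, n))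
    (M : lmodType R) (g : 'I_n -> M) :
  presents A g ->
  presents (map_mx (to_loc q) A) (fun i => frac (g i) (denom1 q) : loc_mod q M).
Proof.
move=> [gsurj gker].
pose gq i : loc_mod q M := frac (g i) (denom1 q).
have combE (v : 'rV[R]_n) (s : denom q) (t : loc_ring q) : to_loc q (val s) * t = 1 ->
    row_comb gq (t *: map_mx (to_loc q) v) = frac (row_comb g v) s.
  move=> st; rewrite linearZ /=.
  have -> : row_comb gq (map_mx (to_loc q) v) = frac (row_comb g v) (denom1 q).
    have fracD (u u' : M) : frac (u + u') (denom1 q) = frac u (denom1 q) + frac u' (denom1 q).
      by rewrite add_frac_same.
    rewrite /row_comb (big_morph _ fracD (frac0 _ _)).
    by apply: eq_bigr => i _; rewrite mxE to_loc_scale.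
  have -> : frac (row_comb g v) (denom1 q) = to_loc q (val s) *: frac (row_comb g v) s.
    by rewrite to_loc_scale; apply: frac_eq; rewrite val_denom1 scale1r.
  by rewrite scalerA mulrC st scale1r.
split.
  move=> y; elim/fracW: y => x s; have [v ->] := gsurj x.
  have [t st] := to_loc_unit (valP s).
  by exists (t *: map_mx (to_loc q) v); rewrite (combE _ s).
have vE m' (v : 'rV[loc_ring q]_m') : exists (s : denom q) (t : loc_ring q) v',
    to_loc q (val s) * t = 1 /\ v = t *: map_mx (to_loc q) v'.
  have [s [v' [sq e]]] := to_loc_surj v.
  have [t st] := to_loc_unit sq; exists (mk_denom sq), t, v'; split=> //.
  by rewrite -e scalerA mulrC st scale1r.
move=> v; split=> [|[w ->]].
  have [s [t [v' [st ->]]]] := vE _ v; rewrite (combE _ s) //.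
  rewrite -(frac0 _ s) => /fracP[w]; rewrite scaler0 -linearZ => /gker[u eu].
  have [r wr] := to_loc_unit (mul_notin (valP w) (valP s)).
  exists ((t * r) *: map_mx (to_loc q) u).
  rewrite -scalemxAl -map_mxM -eu map_mxZ scalerA -mulrA [r * _]mulrC.
  by rewrite wr mulr1.
have [s [t [w' [st ->]]]] := vE _ w.
rewrite -scalemxAl -map_mxM (combE _ s) //.
rewrite (_ : row_comb g _ = 0) ?frac0 //.
by apply/gker; exists w'.
Qed.

(** * The first homology of the twist, and the equivalence *)

Section Main.
Variables (R : comNzRingType) (p : nat) (pcharR : p \in [pchar R]) (e : nat).
Hypothesis noethR : noetherian R.
Local Notation f := (frob_iter e pcharR).
Variable m : prime_idealr R.
Hypothesis m_unit : forall s, s \notin m -> exists t, s * t = 1.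

Lemma frob_acyclic n (d : forall j, 'M[R]_(n j.+1, n j)) J :
  is_complex d -> acyclic d -> (forall j, (J <= j)%N -> contracts 1 d j) ->
  forall j (v : 'rV_(n j.+1)), v *m map_mx f (d j) = 0 ->
  exists w, v = w *m map_mx f (d j.+1).
Proof.
move=> dd exd dJ j v vd.
have [i Ji|s /m_unit[t st] [w sv]] :=
    @frob_acyclic_loc _ _ pcharR e noethR _ _ dd exd m J _ j v vd.
  by exists 1; rewrite ?idealr1 //; apply: dJ.
exists (t *: w); rewrite -scalemxAl -sv scalerA mulrC st.
by rewrite scale1r.
Qed.

Section Hull.
Variables (n : nat -> nat) (L : forall j, 'M[R]_(n j.+1, n j)).
Variables (x : nat -> nat) (D : forall j, 'M[R]_(x j.+1, x j)).
Hypotheses (LL : is_complex L) (exL : acyclic L) (DD : is_complex D) (exD : acyclic D).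
Variables (c : nat) (h : forall j, 'M[R]_(x j.+1, n j)).
Hypothesis Dh : forall j, D j.+1 *m h j = h j.+1 *m L j.
Hypothesis hV : forall j, (c <= j)%N -> exists k, h j *m k = 1%:M /\ k *m h j = 1%:M.

(** In high degrees D is L shifted by one position, so that D and L split at the
same places. *)
Lemma hull_contracts a j : (c <= j)%N -> contracts a L j <-> contracts a D j.+1.
Proof.
move=> cj; have [k0 [hk0 kh0]] := hV cj.
have [k1 [hk1 kh1]] := hV (leqW cj); have [k2 [hk2 kh2]] := hV (leqW (leqW cj)).
split.
  apply: (contracts_retract (n := fun i => x i.+1) (d := fun i => D i.+1)
    (f0 := h j) (f1 := h j.+1) (g1 := k1) (g2 := k2)) => //.
  by rewrite (inverse_commutes Dh kh2 hk1).
apply: (contracts_retract (n' := fun i => x i.+1) (d' := fun i => D i.+1)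
    (f0 := k0) (f1 := k1) (g1 := h j.+1) (g2 := h j.+2)) => //.
by rewrite (inverse_commutes Dh kh1 hk0).
Qed.

(** If the image of the cycle v of the twist of D is a boundary of the twist of L,
then v and that boundary make up a cycle of the twisted cone, which is acyclic. *)
Lemma frob_hull_injective (v : 'rV_(x 1)) (l : 'rV_(n 1)) :
  v *m map_mx f (D 0) = 0 -> v *m map_mx f (h 0) = l *m map_mx f (L 0) ->
  exists w, v = w *m map_mx f (D 1).
Proof.
move=> vD vh.
have coneE j : map_mx f (cone L D h j) =
    cone (fun j => map_mx f (L j)) (fun j => map_mx f (D j)) (fun j => map_mx f (h j)) j.
  by rewrite /cone map_block_mx map_mx0 map_mxN.
have [||j cj||w] :=
  @frob_acyclic (fun j => n j + x j)%N (cone L D h) c _ _ _ 0 (row_mx (- l) v).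
- exact: cone_complex.
- exact: cone_acyclic.
- have [k0 [hk0 kh0]] := hV cj; have [k1 [hk1 kh1]] := hV (leqW cj).
  exact: (cone_contracts Dh kh1 hk0).
- by rewrite coneE cone_mul vD vh oppr0 mulNmx addNr row_mx0.
rewrite coneE -[w]hsubmxK cone_mul => /eq_row_mx[_ ->].
by exists (- rsubmx w); rewrite mulNmx.
Qed.

End Hull.

End Main.

Theorem corollary2p6 (R : comNzRingType) (p : nat) (pcharR : p \in [pchar R])
    (R_gor : gorenstein_local R)
    (n : nat) (n_gt0 : (0 < n)%N)
    (R_rigid : locally_strongly_rigid (frob_module pcharR n))
    (M : lmodType R) (M_fg : fin_gen M) :
  finite_projdim M <->
  (forall P : prime_idealr R, Ass (frob_functor pcharR n M) P -> FPD M P).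
Proof.
have [noethR locR _] := R_gor.
have [m m_unit] := local_ring_unit noethR locR.
have [c gorR] := gorenstein_self_injdim R_gor.
have [k [L [g [[LL exL] Mg]]]] := fin_gen_resolution noethR M_fg.
split.
  move=> /(presentation_projdim LL exL Mg)[J LJ] P _.
  apply: (contracts_projdim (map_complex (to_loc P) LL) (loc_acyclic exL)
    (loc_presents P Mg) (j := J)).
  by have := map_contracts (to_loc P) (LJ J (leqnn J)); rewrite rmorph1.
move=> AssFPD.
have [r [D [k' [e [h [[DD' exD'] Dh hV]]]]]] := gorenstein_hull noethR gorR LL exL.
have DD : is_complex (n := ranks D) (diff D) by move=> j; apply: (DD' j.+1).
have exD : acyclic (n := ranks D) (diff D) by move=> j; apply: (exD' j.+1).
have De : diff D 0 *m e = 0 := DD' 0.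
have exe (v : 'rV_r) : v *m e = 0 -> exists w, v = w *m diff D 0 := exD' 0 v.
pose f := frob_iter n pcharR.
(* The first homology of the twist of D is zero: otherwise it has an
associated prime q, which (2) puts in the locus where D splits. *)
have tor0 (v : 'rV_(ranks D 1)) : v *m map_mx f (diff D 0) = 0 ->
    exists w, v = w *m map_mx f (diff D 1).
  move=> vD; apply: contrapT => nv.
  pose U (u : 'rV_(ranks D 1)) := exists w, u = w *m map_mx f (diff D 1).
  have subU : submodule U.
    split; first by exists 0; rewrite mul0mx.
    by move=> b x y [w ->] [w' ->]; exists (b *: w + w'); rewrite mulmxDl scalemxAl.
  have [|a [q [_ qP]]] := assoc_prime noethR (U := U) (q := m) (z := v) subU.
    move=> s /m_unit[t st] [w sv]; apply: nv; exists (t *: w).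
    by rewrite -scalemxAl -sv scalerA mulrC st scale1r.
  have avD : (a *: v) *m map_mx f (diff D 0) = 0 by rewrite -scalemxAl vD scaler0.
  have [|J LJ] := presentation_projdim (map_complex (to_loc q) LL)
     (loc_acyclic exL) (loc_presents q Mg).
    apply: AssFPD; exists (frob_gen pcharR n g ((a *: v) *m map_mx f (h 0))) => b.
    apply: (iff_trans (qP b)); rewrite frob_gen_scale.
    apply: iff_trans (iff_sym (frob_gen_eq0 pcharR n _ Mg)).
    rewrite scalemxAl; split=> [[w ->]|[l bl]].
      exists (w *m map_mx f (h 1)).
      by rewrite -!mulmxA -!map_mxM Dh.
    apply: (frob_hull_injective noethR m_unit LL exL DD exD Dh hV _ bl).
    by rewrite -scalemxAl avD scaler0.
  have [|s sq [w sw]] :=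
    @frob_acyclic_loc _ _ pcharR n noethR _ _ DD exD q (maxn J c).+1 _ 0 _ avD.
    case=> // j; rewrite ltnS geq_max => /andP[Jj cj].
    have [b bq /(hull_contracts Dh hV b cj) bD] := loc_contracts (LJ j Jj).
    by exists b.
  by case/negP: sq; apply/qP; exists w.
(* The localization at m of the module resolved by D, realized as the image
of e. *)
pose S := loc_ring m.
pose E : {linear 'rV[S]_r -> 'rV[S]_k'} := mulmxr (map_mx (to_loc m) e).
pose X : lmodType S := image_mod E.
pose gX i : X := image_cor E (delta_mx 0 i).
have gXE v : row_comb gX v = image_cor E v.
  by rewrite [RHS]linear_row_comb.
have Xg : presents (map_mx (to_loc m) (diff D 0)) gX.
  split=> [y|v]; first by have [v <-] := image_cor_surj y; exists v; rewrite gXE.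
  rewrite gXE; split=> [/(congr1 val)/= ve|[w ->]].
    have := loc_exact (P := m) (A := diff D 0) (B := e) _ ve; apply.
    by move=> u /exe[w ->]; exists 1; rewrite ?idealr1 //; exists w; rewrite scale1r.
  by apply: val_inj; rewrite /= -mulmxA -map_mxM De map_mx0 mulmx0.
have X_fg : fin_gen X.
  exists r, gX => y; have [v ->] := Xg.1 y.
  by exists (fun i => v 0 i).
have X_tor : Tor_zero 1 X (loc_mod m (frob_module pcharR n)).
  apply: (tor1_zero (map_complex (to_loc m) DD) (loc_acyclic exD) Xg).
  exact: loc_frob_acyclic.
have [|J DJ] := presentation_projdim (map_complex (to_loc m) DD) (loc_acyclic exD) Xg.
  exact: (R_rigid m 1 X).
have cj : (c <= maxn J c)%N by apply: leq_maxr.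
have [|b /m_unit[t bt] bD] := loc_contracts (DJ (maxn J c).+1 _).
  by rewrite leqW // leq_maxl.
apply: (contracts_projdim (j := maxn J c) LL exL Mg).
exact: (contracts_unit bt ((hull_contracts Dh hV b cj).2 bD)).
Qed.
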